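(* Let $X,Y\in T_{(p,f(p))}G\subset T_{(p,f(p))}(M\times M')$. Then $$\overline{\sec}_u(X,Y)=\frac12\left(\sec_u(X,Y)+\sec_u^*(X,Y)\right).$$ In particular, suppose the dualistic structure $(g,\nabla,\nabla^* )$ on $G$ has constant information-geometric sectional curvature $\lambda\in\mathbb R$, meaning that $$\sec_u(X,Y)=\sec_u^*(X,Y)=\lambda\left(g(X,X)g(Y,Y)-g(X,Y)^2\right)$$ for $X,Y$ tangent to $G$ (at the same point). Then $$\overline{\sec}_u(X,Y)=\lambda\left(h(X,X)h(Y,Y)-h(X,Y)^2\right)=\lambda\left(g(X,X)g(Y,Y)-g(X,Y)^2\right)$$ for $X,Y$ tangent to $G$.
   Context: Setting. $M,M'$ are $n$-dimensional smooth manifolds ($n\ge 2$), and $c:M\times M'\to\mathbb R$ is a smooth cost function. In local coordinates $\xi=(\xi^1,\dots,\xi^n)$ on $M$ and $\eta'=(\eta'^{\bar 1},\dots,\eta'^{\bar n})$ on $M'$ write $c_{i:\bar j}=\frac{\partial^2 c}{\partial\xi^i\partial\eta'^{\bar j}}$. The cost is assumed non-degenerate: the matrix $(c_{i:\bar j})$ is invertible at every point. Einstein summation is used. Optimal transport map. $\varphi:M\to\mathbb R$ is smooth and $c$-concave, i.e. there is $\psi:M'\to\mathbb R\cup\{-\infty\}$ with $\varphi(p)=\inf_{q'\in M'}(c(p,q')-\psi(q'))$ for all $p\in M$. For each $p\in M$ there is a unique $q'=:D^c\varphi(p)\in M'$ with $\varphi(p)+\psi(q')=c(p,q')$, and $f=D^c\varphi$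 is a smooth diffeomorphism from $M$ onto its range $f(M)\subset M'$. $\psi$ is the $c$-transform of $\varphi$: $\psi(q)=\inf_{p\in M}(c(p,q)-\varphi(p))$, so $\psi(q)=c(f^{-1}(q),q)-\varphi(f^{-1}(q))$ for $q\in f(M)$. The graph $G=\{(p,f(p)):p\in M\}$ is an $n$-dimensional embedded submanifold of $M\times M'$. $c$-divergence and dualistic structure. For $x=(p,q),\,x'=(p',q')\in G$, $\mathbf D[x:x']=c(p,q')-\varphi(p)-\psi(q')$. Using coordinates $\xi$ on $G$ via $(p,f(p))\mapsto p$ and writing $\mathbf D=\mathbf D[\xi:\xi']$, define $g_{ij}(\xi)=-\frac{\partial}{\partial\xi^i}\frac{\partial}{\partial\xi'^j}\mathbf D\big|_{\xi'=\xi}$ (a Riemannian metric on $G$), $\Gamma_{ijk}(\xi)=-\frac{\partial^2}{\partial\xi^i\partial\xi^j}\frac{\partial}{\partial\xi'^k}\mathbf D\big|_{\xi'=\xi}$, $\Gamma^*_{ijk}(\xi)=-\frac{\partial^2}{\partial\xi'^i\partial\xi'^j}\frac{\partial}{\partial\xi^k}\mathbf D\big|_{\xi'=\xi}$. The torsion-free connections $\nabla,\nabla^*$ on $G$ have Christoffel symbols $\Gamma_{ij}{}^k=\Gamma_{ijm}g^{mk}$ and $\Gamma^*_{ij}{}^k=\Gamma^*_{ijm}g^{mk}$, with $\nabla_{\partial_i}\partial_j=\Gamma_{ij}{}^k\partial_k$ (similarly for $\nabla^*$). Pseudo-Riemannian metric $h$ on $M\times M'$. For $v=a^i\frac{\partial}{\partial\xi^i}+b^{\bar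 i}\frac{\partial}{\partial\eta'^{\bar i}}$ at $(\xi,\eta')$, $h(v,v)=-c_{i:\bar j}(\xi,\eta')a^ib^{\bar j}$, extended by polarization. $\bar\nabla$ is the Levi-Civita connection of $h$. Curvature. The curvature tensor of a connection is $R(X,Y)Z=\nabla_X\nabla_YZ-\nabla_Y\nabla_XZ-\nabla_{[X,Y]}Z$; write $R,R^*,\bar R$ for those of $\nabla,\nabla^*$ (on $G$) and $\bar\nabla$ (on $M\times M'$). Unnormalized sectional curvatures: $\overline{\sec}_u(X,Y)=h(\bar R(X,Y)Y,X)$ for $X,Y$ tangent to $M\times M'$ at the same point; $\sec_u(X,Y)=g(R(X,Y)Y,X)$ and $\sec_u^*(X,Y)=g(R^*(X,Y)Y,X)$ for $X,Y$ tangent to $G$ at the same point. *)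

(* Defs.v *)
From HB Require Import structures.
From mathcomp Require Import all_boot all_order all_algebra.
From mathcomp Require Import all_classical all_reals all_analysis.

Set Implicit Arguments.
Unset Strict Implicit.
Unset Printing Implicit Defensive.

Import Order.TTheory GRing.Theory Num.Theory numFieldNormedType.Exports.
Local Open Scope classical_set_scope.
Local Open Scope ring_scope.

Definition partial (R : realType) (m : nat) (i : 'I_m) (F : 'rV[R]_m -> R) :
  'rV[R]_m -> R := fun x => 'D_(delta_mx 0 i) F x.

(* C^oo on the open set U: every iterated partial derivative is
   (Frechet-)differentiable at every point of U. *)
Definition smooth_on (R : realType) (m : nat) (U : set 'rV[R]_m)
    (F : 'rV[R]_m -> R) : Prop :=
  forall (s : seq 'I_m) (x : 'rV[R]_m), U x ->
    differentiable (foldr (@partial R m) F s) x.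

Definition smooth_vect_on (R : realType) (m k : nat) (U : set 'rV[R]_m)
    (F : 'rV[R]_m -> 'rV[R]_k) : Prop :=
  forall l : 'I_k, smooth_on U (fun x => F x 0 l).

(* [cinv] is only meaningful on [crange u]. *)
Record chart (R : realType) (n : nat) (M : topologicalType) := Chart {
  cdom : set M;
  cmap : M -> 'rV[R]_n;
  cinv : 'rV[R]_n -> M;
  cdom_open : open cdom;
  crange_open : open (cmap @` cdom);
  cmapK : forall p, cdom p -> cinv (cmap p) = p;
  cmap_continuous : {in cdom, continuous cmap};
  cinv_continuous : {in cmap @` cdom, continuous cinv} }.

Definition crange (R : realType) (n : nat) (M : topologicalType)
  (u : chart R n M) : set 'rV[R]_n := cmap u @` cdom u.

(* The atlas need not be maximal; it may be. *)
Record smoothManifold (R : realType) (n : nat) := SmoothManifold {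
  carrier :> topologicalType;
  carrier_hausdorff : hausdorff_space carrier;
  carrier_second_countable : @second_countable carrier;
  atlas : set (chart R n carrier);
  atlas_cover : forall p : carrier, exists2 u, atlas u & cdom u p;
  atlas_compat : forall u v, atlas u -> atlas v ->
    smooth_vect_on (cmap u @` (cdom u `&` cdom v)) (cmap v \o cinv u) }.

Arguments atlas {R n} _ _.

Definition smooth_fun (R : realType) (n : nat) (M : smoothManifold R n)
    (phi : M -> R) : Prop :=
  forall u, atlas M u -> smooth_on (crange u) (phi \o cinv u).

Definition local_expr (R : realType) (n : nat) (M M' : smoothManifold R n)
    (u : chart R n M) (u' : chart R n M') (f : M -> M') :
  'rV[R]_n -> 'rV[R]_n := cmap u' \o f \o cinv u.

(* A is meant to be open. *)
Definition smooth_map_on (R : realType) (n : nat) (M M' : smoothManifold R n)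
    (A : set M) (f : M -> M') : Prop :=
  {in A, continuous f} /\
  forall u u', atlas M u -> atlas M' u' ->
    smooth_vect_on (cmap u @` (cdom u `&` A `&` f @^-1` cdom u'))
      (local_expr u u' f).

Definition diffeo_onto_range (R : realType) (n : nat)
    (M M' : smoothManifold R n) (f : M -> M') : Prop :=
  [/\ smooth_map_on setT f, open (range f) &
      exists2 finv : M' -> M, cancel f finv & smooth_map_on (range f) finv].

(* Product charts of M x M' take values in 'rV_(n + n): the coordinates xi come
   first, then eta'. *)
Definition prod_range (R : realType) (n : nat) (M M' : smoothManifold R n)
    (u : chart R n M) (u' : chart R n M') : set 'rV[R]_(n + n) :=
  [set z | crange u (lsubmx z) /\ crange u' (rsubmx z)].

Definition smooth_cost (R : realType) (n : nat) (M M' : smoothManifold R n)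
    (c : M -> M' -> R) : Prop :=
  forall u u', atlas M u -> atlas M' u' ->
    smooth_on (prod_range u u')
      (fun z => c (cinv u (lsubmx z)) (cinv u' (rsubmx z))).

(* c_{i : bar j} at (xi, eta'). *)
Definition cost_mx (R : realType) (n : nat) (M M' : smoothManifold R n)
    (c : M -> M' -> R) (u : chart R n M) (u' : chart R n M')
    (xi eta : 'rV[R]_n) : 'M[R]_n :=
  \matrix_(i, j)
    partial i (fun a => partial j (fun b => c (cinv u a) (cinv u' b)) eta) xi.

Definition nondegenerate_cost (R : realType) (n : nat) (M M' : smoothManifold R n)
    (c : M -> M' -> R) : Prop :=
  forall u u', atlas M u -> atlas M' u' ->
  forall xi eta, crange u xi -> crange u' eta ->
    cost_mx c u u' xi eta \in unitmx.

Definition c_concave (R : realType) (M M' : Type) (c : M -> M' -> R)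
    (phi : M -> R) : Prop :=
  exists psi : M' -> \bar R, (forall q, psi q != +oo%E) /\
    forall p, (phi p)%:E = ereal_inf [set ((c p q)%:E - psi q)%E | q in setT].

Definition c_transform (R : realType) (M M' : Type) (c : M -> M' -> R)
    (phi : M -> R) (q : M') : \bar R :=
  ereal_inf [set (c p q - phi p)%:E | p in setT].

(* f = D^c phi: for every p, f p is the unique q with
   phi p + psi q = c (p, q), psi being the c-transform of phi. *)
Definition is_c_gradient (R : realType) (M M' : Type) (c : M -> M' -> R)
    (phi : M -> R) (f : M -> M') : Prop :=
  forall p q, ((phi p)%:E + c_transform c phi q = (c p q)%:E)%E <-> q = f p.

(* Local differential geometry on an open subset of R^m. A Christoffel symbol
   Gamma x i j k stands for Gamma_{ij}^k (x). *)
Definition christoffel (R : realType) (m : nat) :=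
  'rV[R]_m -> 'I_m -> 'I_m -> 'I_m -> R.

Definition metric (R : realType) (m : nat) :=
  'rV[R]_m -> 'rV[R]_m -> 'rV[R]_m -> R.

Definition covd (R : realType) (m : nat) (Gamma : christoffel R m)
    (X Y : 'rV[R]_m -> 'rV[R]_m) : 'rV[R]_m -> 'rV[R]_m :=
  fun x => \row_k ('D_(X x) (fun y => Y y 0 k) x +
    \sum_i \sum_j X x 0 i * Y x 0 j * Gamma x i j k).

Definition lie_bracket (R : realType) (m : nat)
    (X Y : 'rV[R]_m -> 'rV[R]_m) : 'rV[R]_m -> 'rV[R]_m :=
  fun x => \row_k ('D_(X x) (fun y => Y y 0 k) x -
                   'D_(Y x) (fun y => X y 0 k) x).

Definition curvature (R : realType) (m : nat) (Gamma : christoffel R m)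
    (X Y Z : 'rV[R]_m -> 'rV[R]_m) : 'rV[R]_m -> 'rV[R]_m :=
  fun x => covd Gamma X (covd Gamma Y Z) x - covd Gamma Y (covd Gamma X Z) x
           - covd Gamma (lie_bracket X Y) Z x.

(* The curvature is tensorial, so tangent vectors v, w at x may be extended to
   arbitrary vector fields; we take the ones with constant coordinates. *)
Definition secu (R : realType) (m : nat) (met : metric R m)
    (Gamma : christoffel R m) (x v w : 'rV[R]_m) : R :=
  met x (curvature Gamma (fun=> v) (fun=> w) (fun=> w) x) v.

(* Torsion-free and metric. This determines Gamma uniquely on U when met is
   non-degenerate there. *)
Definition is_levi_civita (R : realType) (m : nat) (U : set 'rV[R]_m)
    (met : metric R m) (Gamma : christoffel R m) : Prop :=
  [/\ forall i j k, smooth_on U (fun x => Gamma x i j k),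
      forall X Y, smooth_vect_on U X -> smooth_vect_on U Y ->
        forall x, U x ->
        covd Gamma X Y x - covd Gamma Y X x = lie_bracket X Y x &
      forall X Y Z, smooth_vect_on U X -> smooth_vect_on U Y ->
        smooth_vect_on U Z -> forall x, U x ->
        'D_(X x) (fun y => met y (Y y) (Z y)) x =
          met x (covd Gamma X Y x) (Z x) + met x (Y x) (covd Gamma X Z x)].

(* The metric h on M x M' in a product chart: quadratic form and polarization. *)
Definition h_quad (R : realType) (n : nat) (M M' : smoothManifold R n)
    (c : M -> M' -> R) (u : chart R n M) (u' : chart R n M')
    (z v : 'rV[R]_(n + n)) : R :=
  - \sum_i \sum_j cost_mx c u u' (lsubmx z) (rsubmx z) i j *
                  lsubmx v 0 i * rsubmx v 0 j.

Definition h_metric (R : realType) (n : nat) (M M' : smoothManifold R n)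
    (c : M -> M' -> R) (u : chart R n M) (u' : chart R n M') :
  metric R (n + n) :=
  fun z v w => (h_quad c u u' z (v + w) - h_quad c u u' z v
                - h_quad c u u' z w) / 2.

(* The c-divergence D[(p, f p) : (p', f p')] on the graph of f; c_transform is
   finite on the range of a c-gradient. *)
Definition c_divergence (R : realType) (M M' : Type) (c : M -> M' -> R)
    (phi : M -> R) (f : M -> M') (p p' : M) : R :=
  c p (f p') - phi p - fine (c_transform c phi (f p')).

(* On the graph G of f the coordinates are those of the first component, and
   Div xi xi' below is a divergence read in such coordinates. *)
Definition local_div (R : realType) (n : nat) (M M' : smoothManifold R n)
    (c : M -> M' -> R) (phi : M -> R) (f : M -> M') (u : chart R n M)
    (xi xi' : 'rV[R]_n) : R :=
  c_divergence c phi f (cinv u xi) (cinv u xi').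

Definition div_metric_mx (R : realType) (n : nat)
    (Div : 'rV[R]_n -> 'rV[R]_n -> R) (xi : 'rV[R]_n) : 'M[R]_n :=
  \matrix_(i, j) - partial i (fun a => partial j (fun b => Div a b) xi) xi.

Definition div_metric (R : realType) (n : nat)
    (Div : 'rV[R]_n -> 'rV[R]_n -> R) : metric R n :=
  fun xi v w => \sum_i \sum_j div_metric_mx Div xi i j * v 0 i * w 0 j.

(* All indices lowered: Gamma_{ijk}, then Gamma^*_{ijk}. *)
Definition div_gamma_low (R : realType) (n : nat)
    (Div : 'rV[R]_n -> 'rV[R]_n -> R) : christoffel R n :=
  fun xi i j k =>
    - partial i (partial j (fun a => partial k (fun b => Div a b) xi)) xi.

Definition div_gamma_star_low (R : realType) (n : nat)
    (Div : 'rV[R]_n -> 'rV[R]_n -> R) : christoffel R n :=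
  fun xi i j k =>
    - partial i (partial j (fun b => partial k (fun a => Div a b) xi)) xi.

Definition raise_index (R : realType) (n : nat)
    (Div : 'rV[R]_n -> 'rV[R]_n -> R) (Gl : christoffel R n) :
  christoffel R n :=
  fun xi i j k => \sum_m Gl xi i j m * invmx (div_metric_mx Div xi) m k.

Section GraphGeometry.
Context (R : realType) (n : nat) (M M' : smoothManifold R n).
Context (c : M -> M' -> R) (phi : M -> R) (f : M -> M') (u : chart R n M).

Definition g_metric : metric R n := div_metric (local_div c phi f u).

Definition nabla : christoffel R n :=
  raise_index (local_div c phi f u) (div_gamma_low (local_div c phi f u)).

Definition nabla_star : christoffel R n :=
  raise_index (local_div c phi f u) (div_gamma_star_low (local_div c phi f u)).

Definition sec_g : 'rV[R]_n -> 'rV[R]_n -> 'rV[R]_n -> R :=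
  secu g_metric nabla.

Definition sec_g_star : 'rV[R]_n -> 'rV[R]_n -> 'rV[R]_n -> R :=
  secu g_metric nabla_star.

End GraphGeometry.

(* (g, nabla, nabla^* ) has constant information-geometric sectional curvature
   lambda; v and w are the coordinates of tangent vectors of G. *)
Definition constant_ig_curvature (R : realType) (n : nat)
    (M M' : smoothManifold R n) (c : M -> M' -> R) (phi : M -> R)
    (f : M -> M') (lambda : R) : Prop :=
  forall (p : M) (u : chart R n M), atlas M u -> cdom u p ->
  forall v w : 'rV[R]_n,
    let x := cmap u p in let g := g_metric c phi f u in
    let K := lambda * (g x v v * g x w w - g x v w ^+ 2) in
    sec_g c phi f u x v w = K /\ sec_g_star c phi f u x v w = K.

(* The point (p, f p) in a product chart. *)
Definition graph_pt (R : realType) (n : nat) (M M' : smoothManifold R n)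
    (f : M -> M') (u : chart R n M) (u' : chart R n M') (p : M) :
  'rV[R]_(n + n) := row_mx (cmap u p) (cmap u' (f p)).

(* T_(p, f p) G inside T_(p, f p) (M x M'), in a product chart: the vectors
   (a, df_p(a)). The coordinates on G of such a vector X are a = lsubmx X. *)
Definition graph_tangent (R : realType) (n : nat) (M M' : smoothManifold R n)
    (f : M -> M') (u : chart R n M) (u' : chart R n M') (p : M) :
  set 'rV[R]_(n + n) :=
  [set row_mx a
     (\row_k 'D_a (fun x => local_expr u u' f x 0 k) (cmap u p)) | a in setT].

(* Main.v *)
Require Import Defs.
From HB Require Import structures.
From mathcomp Require Import all_boot all_order all_algebra.
From mathcomp Require Import all_classical all_reals all_analysis.
From mathcomp Require Import ring lra.

Set Implicit Arguments.
Unset Strict Implicit.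
Unset Printing Implicit Defensive.

Import Order.TTheory GRing.Theory Num.Theory numFieldNormedType.Exports.
Local Open Scope classical_set_scope.
Local Open Scope ring_scope.

(* If D_v met(z, w) = met(nabla_v z, w) + met(z, nabla'_v w), then
   met(R(v, w) z, s) = - met(z, R'(v, w) s), because second derivatives commute.
   This is used for (g, nabla, nabla^* ) and for the Levi-Civita connection of h.
   Write q for the mixed second derivative of the cost, so that h pairs the
   M-part of one vector with the M'-part of another through -q / 2.  Koszul's
   formula says that the M-part of bar-nabla_X Y only involves the M-parts of X
   and Y, and that along G it is nabla; dually for M'-parts.  Hence the M-part
   of bar-R(X, Y) Z is R(X, Y) Z, and bar-R(X, Y) preserves T M.  Splitting
   X = (v, df v) in h(bar-R(X, Y) Y, X), the summand with (0, df v) gives half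
   of sec_u, while the skew-symmetry of bar-R turns the summand with (v, 0) into
   - g(R(v, w) v, w) / 2 = g(v, R^*(v, w) w) / 2, half of sec_u^*. *)

(** The metric g is not symmetric by construction, and the duality argument needs it on both sides.
    Symmetry comes from the divergence being nonnegative and zero on the diagonal: hence d_v c = d_v
    phi along G, and differentiating this along G writes q(s, df t) as a difference of two symmetric
    second derivatives. Symmetry also makes g non-degenerate, given that q is and that df is
    injective, and it equates the two halves of the polarized h on tangent vectors of G, so that h
    restricts to g.

    The c-transform needs no regularity on M': along the graph it equals c - phi, and the divergence
    sees it only there.

    All fields have constant coordinates, so brackets vanish and a covariant derivative of such a
    field is bilinear in the vectors, with the Christoffel symbols as coefficients. *)

(* Locked so that unification never unfolds the normed-module structures carried
   by 'D_v F x. *)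
HB.lock Definition dd (R : realType) (m : nat) (v : 'rV[R]_m)
  (F : 'rV[R]_m -> R) (x : 'rV[R]_m) : R := 'D_v F x.

Definition dfr (R : realType) (m : nat) (F : 'rV[R]_m -> R) (x : 'rV[R]_m) :=
  differentiable F x.

(** * Directional derivatives of scalar functions on row vectors *)

Section Calculus.
Context (R : realType).
Implicit Types m k : nat.

Lemma ddE m (v : 'rV[R]_m) F x : 'D_v F x = dd v F x.
Proof. by rewrite dd.unlock. Qed.

Lemma dfr_derivable m (F : 'rV[R]_m -> R) x v : dfr F x -> derivable F x v.
Proof. exact: diff_derivable. Qed.

Lemma dfr_is_derive m (F : 'rV[R]_m -> R) x v :
  dfr F x -> is_derive x v F (dd v F x).
Proof. by move=> h; rewrite -ddE; apply: derivableP; apply: dfr_derivable. Qed.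

Lemma is_derive_dd m (F : 'rV[R]_m -> R) x v d : is_derive x v F d -> dd v F x = d.
Proof. by rewrite -ddE => -[]. Qed.

Lemma dfr_cst m (a : R) (x : 'rV[R]_m) : dfr (fun=> a) x.
Proof. exact: differentiable_cst. Qed.

Lemma dd_cst m (v : 'rV[R]_m) (a : R) x : dd v (fun=> a) x = 0.
Proof. by apply: is_derive_dd; exact: is_derive_cst. Qed.

Lemma dfrD m (F G : 'rV[R]_m -> R) x :
  dfr F x -> dfr G x -> dfr (fun y => F y + G y) x.
Proof. exact: differentiableD. Qed.

Lemma ddD m (v : 'rV[R]_m) F G x : dfr F x -> dfr G x ->
  dd v (fun y => F y + G y) x = dd v F x + dd v G x.
Proof.
by move=> hF hG; apply: is_derive_dd; apply: is_deriveD; exact: dfr_is_derive.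
Qed.

Lemma dfrN m (F : 'rV[R]_m -> R) x : dfr F x -> dfr (fun y => - F y) x.
Proof. exact: differentiableN. Qed.

Lemma ddN m (v : 'rV[R]_m) F x : dfr F x ->
  dd v (fun y => - F y) x = - dd v F x.
Proof.
by move=> hF; apply: is_derive_dd; apply: is_deriveN; exact: dfr_is_derive.
Qed.

Lemma dfrB m (F G : 'rV[R]_m -> R) x :
  dfr F x -> dfr G x -> dfr (fun y => F y - G y) x.
Proof. by move=> hF hG; apply: dfrD => //; apply: dfrN. Qed.

Lemma ddB m (v : 'rV[R]_m) F G x : dfr F x -> dfr G x ->
  dd v (fun y => F y - G y) x = dd v F x - dd v G x.
Proof. by move=> hF hG; rewrite ddD ?ddN//; exact: dfrN. Qed.

Lemma dfrM m (F G : 'rV[R]_m -> R) x :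
  dfr F x -> dfr G x -> dfr (fun y => F y * G y) x.
Proof. exact: differentiableM. Qed.

Lemma ddM m (v : 'rV[R]_m) F G x : dfr F x -> dfr G x ->
  dd v (fun y => F y * G y) x = dd v F x * G x + F x * dd v G x.
Proof.
move=> hF hG; rewrite addrC [dd v F x * _]mulrC; apply: is_derive_dd.
by apply: is_deriveM; exact: dfr_is_derive.
Qed.

Lemma ddMl m (v : 'rV[R]_m) a F x : dfr F x ->
  dd v (fun y => a * F y) x = a * dd v F x.
Proof. by move=> h; rewrite ddM ?dd_cst ?mul0r ?add0r//; exact: dfr_cst. Qed.

Lemma ddMr m (v : 'rV[R]_m) a F x : dfr F x ->
  dd v (fun y => F y * a) x = dd v F x * a.
Proof. by move=> h; rewrite ddM ?dd_cst ?mulr0 ?addr0//; exact: dfr_cst. Qed.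

Lemma dfr_sum m (I : Type) (r : seq I) (F : I -> 'rV[R]_m -> R) x :
  (forall i, dfr (F i) x) -> dfr (fun y => \sum_(i <- r) F i y) x.
Proof.
move=> h; elim: r => [|i r IH].
  by under [X in dfr X]eq_fun do rewrite big_nil; exact: dfr_cst.
by under [X in dfr X]eq_fun do rewrite big_cons; exact: dfrD.
Qed.

Lemma dd_sum m (v : 'rV[R]_m) (I : Type) (r : seq I) (F : I -> 'rV[R]_m -> R) x :
  (forall i, dfr (F i) x) ->
  dd v (fun y => \sum_(i <- r) F i y) x = \sum_(i <- r) dd v (F i) x.
Proof.
move=> h; elim: r => [|i r IH].
  by rewrite big_nil; under [X in dd v X]eq_fun do rewrite big_nil; exact: dd_cst.
rewrite big_cons -IH -ddD//; last exact: dfr_sum.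
by congr dd; apply/funext => y; rewrite big_cons.
Qed.

Lemma dfr_coord m (j : 'I_m) (x : 'rV[R]_m) : dfr (fun y => y 0 j) x.
Proof. exact: differentiable_coord. Qed.

Lemma nbhs_of_open m (U : set 'rV[R]_m) (P : 'rV[R]_m -> Prop) x :
  open U -> U x -> (forall y, U y -> P y) -> \forall y \near x, P y.
Proof. by move=> oU Ux h; apply: filterS h _; exact: open_nbhs_nbhs. Qed.

Lemma eq_dd m (U : set 'rV[R]_m) (F G : 'rV[R]_m -> R) v x :
  open U -> U x -> (forall y, U y -> F y = G y) -> dd v F x = dd v G x.
Proof.
move=> oU Ux h; rewrite -!ddE; apply: near_eq_derive.
exact: nbhs_of_open oU Ux h.
Qed.

Lemma nbhs_rowP m (P : 'rV[R]_m -> Prop) (x : 'rV[R]_m) :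
  nbhs x P <-> exists2 e, 0 < e & forall y : 'rV[R]_m, `|y - x| < e -> P y.
Proof.
split=> [/(@nbhs_normP R 'rV[R]_m)[e e0 he]|[e e0 he]].
  by exists e => // y hy; apply: he; rewrite /ball_ /= distrC.
apply/(@nbhs_normP R 'rV[R]_m); exists e => // y.
by rewrite /ball_ /= distrC; exact: he.
Qed.

(** Near 0 the remainder of [g] equals that of [f], so the differential of [f], being continuous, is
    also that of [g] by [diff_unique]. *)
Lemma near_eq_differentiable (V W : normedModType R) (f g : V -> W) (x : V) :
  (\forall y \near x, f y = g y) -> differentiable f x -> differentiable g x.
Proof.
move=> fg hf; have [cf /eqaddoP hdf] := (diff_locallyP x f).1 hf.
have hdg : g \o shift x = cst (g x) + 'd f x +o_ 0 id.
  apply/eqaddoP => e e0.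
  have hn : \forall h \near 0, f (h + x) = g (h + x).
    move: fg => /nbhs_normP[d /= d0 hd]; apply/nbhs_normP; exists d => //= h.
    rewrite /ball_ /= sub0r normrN => hh; apply: hd.
    by rewrite /ball_ /= opprD addrCA subrr addr0 normrN.
  apply: filterS2 (hdf e e0) hn => y + hy.
  rewrite (_ : (g \o shift x - _) y = (f \o shift x - (cst (f x) + 'd f x)) y) //.
  transitivity (g (y + x) - (g x + 'd f x y)); first by [].
  by rewrite -hy -(nbhs_singleton fg).
have dg := diff_unique cf hdg.
by apply/diff_locallyP; rewrite dg.
Qed.

Lemma eq_dfr m (U : set 'rV[R]_m) (F G : 'rV[R]_m -> R) x :
  open U -> U x -> (forall y, U y -> F y = G y) -> dfr F x -> dfr G x.
Proof.
move=> oU Ux h; apply: near_eq_differentiable.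
exact: nbhs_of_open oU Ux h.
Qed.

Lemma dfrP m (F : 'rV[R]_m -> R) x e : dfr F x -> 0 < e ->
  nbhs (0 : 'rV[R]_m)
    (fun h : 'rV[R]_m => `|F (h + x) - F x - dd h F x| <= e * `|h|).
Proof.
move=> hF e0; have [cF /eqaddoP hdF] := (diff_locallyP x F).1 hF.
apply: filterS (hdF e e0) => y.
by rewrite -ddE deriveE// opprD addrA.
Qed.

Lemma ddZv m a (v : 'rV[R]_m) F x : dfr F x -> dd (a *: v) F x = a * dd v F x.
Proof. by move=> h; rewrite -!ddE !deriveE// linearZ. Qed.

Lemma ddDv m (v w : 'rV[R]_m) F x :
  dfr F x -> dd (v + w) F x = dd v F x + dd w F x.
Proof. by move=> h; rewrite -!ddE !deriveE// linearD. Qed.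

Lemma dd0v m F (x : 'rV[R]_m) : dd 0 F x = 0.
Proof. by rewrite -ddE derive0. Qed.

Lemma dd_sumv m (I : Type) (r : seq I) (v : I -> 'rV[R]_m) F x : dfr F x ->
  dd (\sum_(i <- r) v i) F x = \sum_(i <- r) dd (v i) F x.
Proof.
move=> h; elim: r => [|i r IH]; first by rewrite !big_nil dd0v.
by rewrite !big_cons ddDv// IH.
Qed.

Lemma dd_partial m (v : 'rV[R]_m) F x : dfr F x ->
  dd v F x = \sum_i v 0 i * dd (delta_mx 0 i) F x.
Proof.
move=> h; rewrite [in LHS](row_sum_delta v) dd_sumv//.
by apply: eq_bigr => i _; rewrite ddZv.
Qed.

Lemma differentiable_row m k (f : 'rV[R]_m -> 'rV[R]_k) x :
  (forall l, dfr (fun y => f y 0 l) x) -> differentiable f x.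
Proof.
move=> h.
have -> : f = \sum_l (fun y => f y 0 l *: delta_mx 0 l).
  by apply/funext => y; rewrite fct_sumE -row_sum_delta.
apply: differentiable_sum => l; apply: differentiableZl; exact: h.
Qed.

(** The image of [v] under the differential of [f], kept coordinatewise so that only scalar
    functions are differentiated. *)
Definition dvec m k (v : 'rV[R]_m) (f : 'rV[R]_m -> 'rV[R]_k) (x : 'rV[R]_m) :
  'rV[R]_k := \row_l dd v (fun y => f y 0 l) x.

Lemma dfr_comp m k (f : 'rV[R]_m -> 'rV[R]_k) (F : 'rV[R]_k -> R) x :
  (forall l, dfr (fun y => f y 0 l) x) -> dfr F (f x) ->
  dfr (fun y => F (f y)) x.
Proof. by move=> /differentiable_row hf hF; exact: differentiable_comp. Qed.

Lemma dd_comp m k (f : 'rV[R]_m -> 'rV[R]_k) (F : 'rV[R]_k -> R) v x :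
  (forall l, dfr (fun y => f y 0 l) x) -> dfr F (f x) ->
  dd v (fun y => F (f y)) x = dd (dvec v f x) F (f x).
Proof.
move=> hf' hF; have hf := differentiable_row hf'.
rewrite -!ddE.
have -> : dvec v f x = 'd f x v.
  rewrite -deriveE// derive_mx; last exact: diff_derivable.
  by apply/rowP => l; rewrite !mxE ddE.
rewrite -deriveE// deriveE; last exact: differentiable_comp.
have -> : (fun y => F (f y)) = F \o f by [].
by rewrite diff_comp//= [in RHS]deriveE// [in RHS]deriveE.
Qed.

Lemma is_derive_line m (F : 'rV[R]_m -> R) (x v : 'rV[R]_m) (s : R) :
  dfr F (x + s *: v) ->
  is_derive s (1 : R) (fun t => F (x + t *: v)) (dd v F (x + s *: v)).
Proof.
move=> hF; have [d1 d2] := dfr_is_derive v hF.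
have e : (fun h : R => h^-1 *:
      (((fun t => F (x + t *: v)) \o shift s) (h *: (1 : R)) -
        F (x + s *: v))) =
    (fun h : R => h^-1 *: ((F \o shift (x + s *: v)) (h *: v) - F (x + s *: v))).
  apply/funext => h /=; congr (_ *: (F _ - _)).
  by rewrite scaler1 scalerDl addrCA.
apply: DeriveDef.
  by rewrite /derivable e.
by rewrite /derive e.
Qed.
End Calculus.

(** * Symmetry of second derivatives *)

Section Schwarz.
Context (R : realType).

Lemma normrZ_le (V : normedModType R) (a t : R) (v : V) :
  0 <= a <= 1 -> 0 < t -> `|(a * t) *: v| <= t * `|v|.
Proof.
move=> /andP[a0 a1] t0; rewrite normrZ normrM (ger0_norm a0) (gtr0_norm t0).
by rewrite ler_wpM2r// ler_piMl// ltW.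
Qed.

(* The mean value theorem in direction v turns the second difference into the
   increment of dd v F in direction w. *)
Lemma second_difference m (U : set 'rV[R]_m) (F : 'rV[R]_m -> R)
    (x v w : 'rV[R]_m) (e : R) :
  open U -> U x -> (forall y, U y -> dfr F y) -> dfr (dd v F) x -> 0 < e ->
  exists2 d : R, 0 < d & forall t, 0 < t -> t < d ->
    `|F (x + t *: v + t *: w) - F (x + t *: v) - F (x + t *: w) + F x
      - t ^+ 2 * dd w (dd v F) x| <= e * t ^+ 2.
Proof.
move=> oU Ux hF hvF e0.
(* The expansion of [dd v F] is used at the increments t w + s v and s v with 0 < s < t; [K] bounds
   the sum of their norms divided by t, and the 1 keeps it positive. *)
have K0 : 0 < `|w| + `|v| + `|v| + 1.
  by rewrite ltr_pwDr// !addr_ge0.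
set K := `|w| + `|v| + `|v| + 1 in K0.
have /nbhs_rowP[d1 d10 hd1] := dfrP hvF (divr_gt0 e0 K0).
have /nbhs_rowP[d2 d20 hd2] : nbhs x U by exact: open_nbhs_nbhs.
exists (Num.min d1 d2 / K); first by rewrite divr_gt0// lt_min d10 d20.
move=> t t0; rewrite ltr_pdivlMr// lt_min => /andP[td1 td2].
have small a b : 0 <= a <= 1 -> 0 <= b <= 1 ->
    `|(a * t) *: w + (b * t) *: v| <= t * (`|w| + `|v|).
  move=> ha hb.
  apply: le_trans (ler_normD _ _) _.
  by rewrite mulrDr lerD// normrZ_le.
have smallK a b : 0 <= a <= 1 -> 0 <= b <= 1 ->
    `|(a * t) *: w + (b * t) *: v| < t * K.
  move=> ha hb; apply: le_lt_trans (small _ _ ha hb) _.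
  rewrite ltr_pM2l// /K -!addrA ltrD2l ltrDl ltr_pwDr//.
have inU a b : 0 <= a <= 1 -> 0 <= b <= 1 ->
    U (x + (a * t) *: w + (b * t) *: v).
  move=> ha hb; apply: hd2.
  by rewrite -[x + _ + _]addrA [x + _]addrC addrK; apply: lt_trans td2; exact: smallK.
(* The second difference is [phi t - phi 0]. *)
pose phi (s : R) := F (x + t *: w + s *: v) - F (x + s *: v).
pose dphi (s : R) := dd v F (x + t *: w + s *: v) - dd v F (x + s *: v).
have hphi s : 0 <= s <= t -> is_derive s (1 : R) phi (dphi s).
  move=> /andP[s0 st].
  have hb : 0 <= s / t <= 1.
    by rewrite divr_ge0 ?(ltW t0)//= ler_pdivrMr// mul1r.
  have e1 : s / t * t = s by rewrite divfK// gt_eqF.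
  apply: is_deriveB; apply: is_derive_line; apply: hF.
    by have := @inU 1 (s / t); rewrite mul1r e1; apply=> //; rewrite ler01 lexx.
  have := @inU 0 (s / t); rewrite mul0r e1 scale0r addr0; apply=> //.
  by rewrite ler01 lexx.
have [s] : exists2 s, s \in `]0, t[%R & phi t - phi 0 = dphi s * (t - 0).
  apply: MVT => //.
    by move=> s; rewrite in_itv/= => /andP[/ltW s0 /ltW st]; apply: hphi; rewrite s0.
  apply: derivable_within_continuous => s; rewrite in_itv /= => hs.
  by have [] := hphi _ hs.
rewrite in_itv /= subr0 => /andP[s0 st] hs.
have hb : 0 <= s / t <= 1.
  by rewrite divr_ge0 ?(ltW t0) ?(ltW s0)//= ler_pdivrMr// mul1r ltW.
have e1 : s / t * t = s by rewrite divfK// gt_eqF.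
pose h1 := t *: w + s *: v; pose h2 := s *: v.
have b1 : `|h1| <= t * (`|w| + `|v|).
  have := @small 1 (s / t); rewrite mul1r e1; apply=> //.
  by rewrite ler01 lexx.
have b2 : `|h2| <= t * `|v|.
  by rewrite /h2 -e1 normrZ_le.
have c1 : `|h1| < d1.
  have := @smallK 1 (s / t); rewrite mul1r e1 => H.
  by apply: lt_trans td1; apply: H => //; rewrite ler01 lexx.
have c2 : `|h2| < d1.
  have := @smallK 0 (s / t); rewrite mul0r e1 scale0r add0r => H.
  by apply: lt_trans td1; apply: H => //; rewrite ler01 lexx.
have := hd1 h1; rewrite subr0 => /(_ c1).
have := hd1 h2; rewrite subr0 => /(_ c2).
have -> : dd h1 (dd v F) x = t * dd w (dd v F) x + dd h2 (dd v F) x.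
  by rewrite ddDv// ddZv.
have -> : F (x + t *: v + t *: w) - F (x + t *: v) - F (x + t *: w) + F x =
    phi t - phi 0.
  rewrite /phi !scale0r !addr0 (addrAC x (t *: w)).
  by move: (F _) (F (x + t *: v)) (F (x + t *: w)) (F x) => a b c d; ring.
rewrite hs /dphi -(addrA x (t *: w)) -/h1 -/h2 [x + h1]addrC [x + h2]addrC.
move: (dd h2 _ x) (dd w _ x) (dd v F x) (dd v F (h1 + x)) (dd v F (h2 + x)).
move=> L2 Lw g g1 g2 H2 H1.
(* Subtracting the two first-order expansions at x cancels [g] and [L2] and leaves t Lw. *)
have -> : (g1 - g2) * t - t ^+ 2 * Lw =
    t * ((g1 - g - (t * Lw + L2)) - (g2 - g - L2)) by ring.
rewrite normrM (gtr0_norm t0) expr2 mulrCA ler_pM2l//.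
apply: le_trans (ler_normB _ _) _.
apply: le_trans (lerD H1 H2) _.
rewrite -mulrDr -mulrA ler_pM2l// ler_pdivrMl// [_ * t]mulrC.
apply: le_trans (lerD b1 b2) _.
by rewrite -mulrDr ler_pM2l// /K lerDl.
Qed.

(** The second difference does not change when [v] and [w] are exchanged, and t^2 times either mixed
    derivative is within e t^2 / 2 of it. *)
Lemma dd_swap m (U : set 'rV[R]_m) (F : 'rV[R]_m -> R) (x v w : 'rV[R]_m) :
  open U -> U x -> (forall y, U y -> dfr F y) ->
  dfr (dd v F) x -> dfr (dd w F) x ->
  dd w (dd v F) x = dd v (dd w F) x.
Proof.
move=> oU Ux hF hv hw; apply/eqP; rewrite -subr_eq0 -normr_le0.
apply/ler_addgt0Pl => e e0; rewrite addr0.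
have e20 : 0 < e / 2 by rewrite divr_gt0.
have [d1 d10 h1] := second_difference w oU Ux hF hv e20.
have [d2 d20 h2] := second_difference v oU Ux hF hw e20.
pose t := Num.min d1 d2 / 2.
have m0 : 0 < Num.min d1 d2 by rewrite lt_min d10.
have t0 : 0 < t by rewrite divr_gt0.
have tm : t < Num.min d1 d2 by rewrite ltr_pdivrMr// ltr_pMr// ltr1n.
move: tm; rewrite lt_min => /andP[td1 td2].
have := h1 _ t0 td1; have := h2 _ t0 td2.
rewrite [x + t *: w + t *: v]addrAC.
move: (F _) (F (x + t *: v)) (F (x + t *: w)) (F x) (dd _ _ _) (dd v (dd w F) x).
move=> a b c d p q.
have tt : 0 < t ^+ 2 by rewrite exprn_gt0.
move=> H2 H1; rewrite -(ler_pM2l tt) -{1}(gtr0_norm tt) -normrM.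
have -> : t ^+ 2 * (p - q) =
    (a - c - b + d - t ^+ 2 * q) - (a - b - c + d - t ^+ 2 * p) by ring.
apply: le_trans (ler_normB _ _) _; apply: le_trans (lerD H2 H1) _.
by rewrite -mulrDl -splitr mulrC.
Qed.
End Schwarz.

(** * Bilinear forms, connections and curvature in coordinates *)

Definition bil (R : realType) (m : nat) (A : 'M[R]_m) (v w : 'rV[R]_m) : R :=
  \sum_i \sum_j A i j * v 0 i * w 0 j.

(** nabla_v w at x for constant fields, where only the Christoffel term remains. *)
Definition bilc (R : realType) (m : nat) (Gamma : christoffel R m) x
    (v w : 'rV[R]_m) : 'rV[R]_m :=
  \row_k \sum_i \sum_j v 0 i * w 0 j * Gamma x i j k.

Definition cov (R : realType) (m : nat) (Gamma : christoffel R m)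
    (v : 'rV[R]_m) (Z : 'rV[R]_m -> 'rV[R]_m) x : 'rV[R]_m :=
  dvec v Z x + bilc Gamma x v (Z x).

(** R(v, w) z on constant fields, whose bracket term vanishes; see [curvature_cst]. *)
Definition curv (R : realType) (m : nat) (Gamma : christoffel R m) x
    (v w z : 'rV[R]_m) : 'rV[R]_m :=
  cov Gamma v (fun y => bilc Gamma y w z) x -
  cov Gamma w (fun y => bilc Gamma y v z) x.

Section Bilinear.
Context (R : realType) (m : nat).
Implicit Types (v w z x : 'rV[R]_m) (A : 'M[R]_m) (Gamma : christoffel R m).

Lemma bilDl A v w z : bil A (v + w) z = bil A v z + bil A w z.
Proof.
rewrite /bil -big_split; apply: eq_bigr => i _; rewrite -big_split.
by apply: eq_bigr => j _; rewrite mxE mulrDr mulrDl.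
Qed.

Lemma bilDr A v w z : bil A z (v + w) = bil A z v + bil A z w.
Proof.
rewrite /bil -big_split; apply: eq_bigr => i _; rewrite -big_split.
by apply: eq_bigr => j _; rewrite mxE mulrDr.
Qed.

Lemma bilNl A v w : bil A (- v) w = - bil A v w.
Proof.
rewrite /bil -sumrN; apply: eq_bigr => i _; rewrite -sumrN.
by apply: eq_bigr => j _; rewrite mxE mulrN mulNr.
Qed.

Lemma bilNr A v w : bil A v (- w) = - bil A v w.
Proof.
rewrite /bil -sumrN; apply: eq_bigr => i _; rewrite -sumrN.
by apply: eq_bigr => j _; rewrite mxE mulrN.
Qed.

Lemma bil_sumr A (I : Type) (r : seq I) (v : I -> 'rV[R]_m) w :
  bil A w (\sum_(i <- r) v i) = \sum_(i <- r) bil A w (v i).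
Proof.
elim: r => [|i r IH]; last by rewrite !big_cons bilDr IH.
rewrite !big_nil /bil big1// => i _; rewrite big1// => j _.
by rewrite mxE mulr0.
Qed.

Lemma bilZl A a v w : bil A (a *: v) w = a * bil A v w.
Proof.
rewrite /bil mulr_sumr; apply: eq_bigr => i _; rewrite mulr_sumr.
by apply: eq_bigr => j _; rewrite mxE; ring.
Qed.

Lemma bilZr A a v w : bil A v (a *: w) = a * bil A v w.
Proof.
rewrite /bil mulr_sumr; apply: eq_bigr => i _; rewrite mulr_sumr.
by apply: eq_bigr => j _; rewrite mxE; ring.
Qed.

Lemma bilcE Gamma x v w k :
  bilc Gamma x v w 0 k = \sum_i \sum_j v 0 i * w 0 j * Gamma x i j k.
Proof. by rewrite mxE. Qed.

Lemma bilc_delta Gamma x i j k :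
  bilc Gamma x (delta_mx 0 i) (delta_mx 0 j) 0 k = Gamma x i j k.
Proof.
rewrite bilcE (bigD1 i)//= (bigD1 j)//= !mxE !eqxx !mul1r !big1 ?addr0//.
  by move=> l li; rewrite big1// => p _; rewrite !mxE (negbTE li) andbF !mul0r.
by move=> l lj; rewrite !mxE (negbTE lj) andbF mulr0 mul0r.
Qed.

Lemma dvec_cst k v (a : 'rV[R]_k) x : dvec v (fun=> a) x = 0.
Proof. by apply/rowP => l; rewrite !mxE dd_cst. Qed.

Lemma dfr_bilc Gamma v w x k : (forall i j, dfr (fun y => Gamma y i j k) x) ->
  dfr (fun y => bilc Gamma y v w 0 k) x.
Proof.
move=> h; under [X in dfr X]eq_fun do rewrite bilcE.
apply: dfr_sum => i; apply: dfr_sum => j; apply: dfrM => //; exact: dfr_cst.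
Qed.

Lemma covd_cst Gamma v (Z : 'rV[R]_m -> 'rV[R]_m) x :
  covd Gamma (fun=> v) Z x = cov Gamma v Z x.
Proof. by apply/rowP => k; rewrite !mxE ddE. Qed.

Lemma covd_cst2 Gamma v w x :
  covd Gamma (fun=> v) (fun=> w) x = bilc Gamma x v w.
Proof. by rewrite covd_cst /cov dvec_cst add0r. Qed.

Lemma curvature_cst Gamma v w z x :
  curvature Gamma (fun=> v) (fun=> w) (fun=> z) x = curv Gamma x v w z.
Proof.
rewrite /curvature.
have -> : lie_bracket (fun=> v) (fun=> w) = (fun=> 0).
  by apply/funext => y; apply/rowP => k; rewrite !mxE !ddE !dd_cst subrr.
have e u : covd Gamma (fun=> u) (fun=> z) = (fun y => bilc Gamma y u z).
  by apply/funext => y; rewrite covd_cst2.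
rewrite !e !covd_cst.
have -> : bilc Gamma x 0 z = 0.
  apply/rowP => k; rewrite bilcE mxE big1// => i _; rewrite big1// => j _.
  by rewrite mxE !mul0r.
by rewrite subr0.
Qed.

Lemma bil0l (M : 'M[R]_m) v : bil M 0 v = 0.
Proof. by rewrite -(scale0r 0) bilZl mul0r. Qed.

Lemma bil0r (M : 'M[R]_m) v : bil M v 0 = 0.
Proof. by rewrite -(scale0r 0) bilZr mul0r. Qed.

Lemma bil_unitl (M : 'M[R]_m) v :
  M \in unitmx -> (forall s, bil M v s = 0) -> v = 0.
Proof.
move=> uM hv; rewrite -(mulmxK uM v) (_ : v *m M = 0) ?mul0mx//.
apply/rowP => j; rewrite !mxE -[RHS](hv (delta_mx 0 j)); apply: eq_bigr => i _.
rewrite (bigD1 j)//= big1 ?addr0 => [|k kj].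
  by rewrite mxE !eqxx mulr1 mulrC.
by rewrite mxE (negbTE kj) andbF mulr0.
Qed.

Lemma bil_unitr (M : 'M[R]_m) v :
  M \in unitmx -> (forall s, bil M s v = 0) -> v = 0.
Proof.
rewrite -unitmx_tr => uM hv; apply: (bil_unitl uM) => s; rewrite -[RHS](hv s).
rewrite /bil exchange_big; apply: eq_bigr => i _; apply: eq_bigr => j _.
by rewrite mxE mulrAC.
Qed.

End Bilinear.

(** * Curvatures of two connections that are dual for a bilinear form *)

Section Duality.
Context (R : realType) (m : nat) (V : set 'rV[R]_m).
Context (G : 'rV[R]_m -> 'M[R]_m) (Gamma Gamma' : christoffel R m).
Hypothesis oV : open V.
Hypothesis dG : forall x i j, V x -> dfr (fun y => G y i j) x.
Hypothesis dGamma : forall x i j k, V x -> dfr (fun y => Gamma y i j k) x.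
Hypothesis dGamma' : forall x i j k, V x -> dfr (fun y => Gamma' y i j k) x.
Hypothesis dual : forall x v z w, V x ->
  dd v (fun y => bil (G y) z w) x =
    bil (G x) (bilc Gamma x v z) w + bil (G x) z (bilc Gamma' x v w).

Lemma dfr_bil (Z W : 'rV[R]_m -> 'rV[R]_m) x : V x ->
  (forall k, dfr (fun y => Z y 0 k) x) -> (forall k, dfr (fun y => W y 0 k) x) ->
  dfr (fun y => bil (G y) (Z y) (W y)) x.
Proof.
move=> Vx hZ hW; apply: dfr_sum => i; apply: dfr_sum => j.
by apply: dfrM => //; apply: dfrM => //; exact: dG.
Qed.

(** [dual] speaks of constant fields; the Leibniz rule adds the derivatives of the coordinates of Z
    and W, which are the [dvec] halves of the covariant derivatives. *)
Lemma dd_bil (Z W : 'rV[R]_m -> 'rV[R]_m) x v : V x ->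
  (forall k, dfr (fun y => Z y 0 k) x) -> (forall k, dfr (fun y => W y 0 k) x) ->
  dd v (fun y => bil (G y) (Z y) (W y)) x =
    bil (G x) (cov Gamma v Z x) (W x) + bil (G x) (Z x) (cov Gamma' v W x).
Proof.
move=> Vx hZ hW; rewrite /cov bilDl bilDr.
transitivity (dd v (fun y => bil (G y) (Z x) (W x)) x +
    bil (G x) (dvec v Z x) (W x) + bil (G x) (Z x) (dvec v W x)); last first.
  by rewrite dual//; ring.
have hGZ i j : dfr (fun y => G y i j * Z y 0 i) x by apply: dfrM => //; exact: dG.
have hGZW i j : dfr (fun y => G y i j * Z y 0 i * W y 0 j) x by exact: dfrM.
have hG i j : dfr (fun y => G y i j) x by exact: dG.
have hG1 a i j : dfr (fun y => G y i j * a) x by apply: dfrM => //; exact: dfr_cst.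
rewrite /bil !dd_sum; last 2 first.
- by move=> i; apply: dfr_sum => j; apply: dfrM => //; exact: dfr_cst.
- by move=> i; apply: dfr_sum.
rewrite -!big_split; apply: eq_bigr => i _ /=.
rewrite !dd_sum//; last by move=> j; apply: dfrM => //; exact: dfr_cst.
rewrite -!big_split; apply: eq_bigr => j _ /=.
rewrite ddM// ddM// ddMr// ddMr// !mxE; ring.
Qed.

Lemma dual_curv x v w z s : V x ->
  bil (G x) (curv Gamma x v w z) s = - bil (G x) z (curv Gamma' x v w s).
Proof.
move=> Vx; pose f y := bil (G y) z s.
have hc (a : 'rV[R]_m) y k : dfr (fun=> a 0 k) y by exact: dfr_cst.
have hb a b y k : V y -> dfr (fun y => bilc Gamma y a b 0 k) y.
  by move=> Vy; apply: dfr_bilc => i j; exact: dGamma.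
have hb' a b y k : V y -> dfr (fun y => bilc Gamma' y a b 0 k) y.
  by move=> Vy; apply: dfr_bilc => i j; exact: dGamma'.
have hf y : V y -> dfr f y.
  by move=> Vy; apply: (@dfr_bil (fun=> z) (fun=> s)) => //.
pose p a y := bil (G y) (bilc Gamma y a z) s + bil (G y) z (bilc Gamma' y a s).
have hp a y : V y -> dfr (p a) y.
  move=> Vy; apply: dfrD.
    by apply: (@dfr_bil _ (fun=> s)) => // k; exact: hb.
  by apply: (@dfr_bil (fun=> z)) => // k; exact: hb'.
have df a y : V y -> dd a f y = p a y by move=> Vy; rewrite dual.
(* [G] is only assumed differentiable once; the derivative of f is differentiable because [dual]
   rewrites it as [p a]. *)
have hdf a : dfr (dd a f) x.
  by apply: (@eq_dfr _ _ V (p a)) => //; [move=> y Vy; rewrite df|exact: hp].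
(* The two terms that differentiate both z and s are swapped when a and b are, so they cancel in the
   commutator and the curvature terms remain. *)
have H a b : dd a (dd b f) x =
    bil (G x) (cov Gamma a (fun y => bilc Gamma y b z) x) s +
    bil (G x) (bilc Gamma x b z) (bilc Gamma' x a s) +
    (bil (G x) (bilc Gamma x a z) (bilc Gamma' x b s) +
     bil (G x) z (cov Gamma' a (fun y => bilc Gamma' y b s) x)).
  rewrite (@eq_dd _ _ V (dd b f) (p b))//; last by move=> y Vy; exact: df.
  rewrite ddD; last 2 first.
  - by apply: (@dfr_bil _ (fun=> s)) => // k; exact: hb.
  - by apply: (@dfr_bil (fun=> z)) => // k; exact: hb'.
  rewrite (@dd_bil _ (fun=> s))//; last by move=> k; exact: hb.
  rewrite (@dd_bil (fun=> z))//; last by move=> k; exact: hb'.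
  by rewrite {2}/cov {2}/cov !dvec_cst !add0r.
have := dd_swap oV Vx hf (hdf v) (hdf w).
rewrite !H /curv.
move: (cov Gamma v _ x) (cov Gamma w _ x) (cov Gamma' v _ x) (cov Gamma' w _ x).
move=> a b c d; rewrite !bilDl !bilDr !bilNl !bilNr.
move: (bil _ a s) (bil _ b s) (bil _ z c) (bil _ z d).
move: (bil _ (bilc _ _ v z) _) (bil _ (bilc _ _ w z) _).
by move=> p1 p2 p3 p4 p5 p6 E; lra.
Qed.
End Duality.

(** * Stability of smoothness on an open set *)

Section Smooth.
Context (R : realType) (m : nat) (U : set 'rV[R]_m).
Hypothesis oU : open U.
Implicit Types (F G : 'rV[R]_m -> R) (x v w : 'rV[R]_m).

Lemma partialE i F x : partial i F x = dd (delta_mx 0 i) F x.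
Proof. by rewrite /partial ddE. Qed.

Lemma smooth_dfr F x : smooth_on U F -> U x -> dfr F x.
Proof. by move=> h Ux; exact: (h [::]). Qed.

Lemma eq_foldr_partial F G s x : (forall y, U y -> F y = G y) -> U x ->
  foldr (@partial R m) F s x = foldr (@partial R m) G s x.
Proof.
move=> h; elim: s x => [|i s IH] x Ux /=; first exact: h.
by rewrite !partialE; apply: eq_dd oU Ux _ => y; exact: IH.
Qed.

Lemma eq_smooth_on F G : (forall y, U y -> F y = G y) ->
  smooth_on U F -> smooth_on U G.
Proof.
move=> h hF s x Ux; apply: (eq_dfr oU Ux) (hF s x Ux) => y Uy.
exact: eq_foldr_partial.
Qed.

Lemma smooth_on_lin a F G : smooth_on U F -> smooth_on U G ->
  smooth_on U (fun y => a * F y + G y).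
Proof.
move=> hF hG.
have H s x : U x -> foldr (@partial R m) (fun y => a * F y + G y) s x =
    a * foldr (@partial R m) F s x + foldr (@partial R m) G s x.
  elim: s x => [//|i s IH] x Ux /=; rewrite !partialE.
  rewrite (eq_dd _ oU Ux IH) ddD ?ddMl//; first exact: hF.
  - by apply: dfrM; [exact: dfr_cst|exact: hF].
  - exact: hG.
move=> s x Ux; apply: (eq_dfr oU Ux (fun y Uy => esym (H s y Uy))).
apply: dfrD; last exact: hG.
by apply: dfrM; [exact: dfr_cst|exact: hF].
Qed.

Lemma smooth_on_cst (a : R) : smooth_on U (fun=> a).
Proof.
have H s : exists b, foldr (@partial R m) (fun=> a) s = (fun=> b).
  elim: s => [|i s [b /= ->]]; first by exists a.
  by exists 0; apply/funext => y; rewrite partialE dd_cst.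
by move=> s x Ux; case: (H s) => b ->; exact: dfr_cst.
Qed.

Lemma smooth_on_sum (I : Type) (r : seq I) (F : I -> 'rV[R]_m -> R) :
  (forall i, smooth_on U (F i)) -> smooth_on U (fun y => \sum_(i <- r) F i y).
Proof.
move=> h; elim: r => [|i r IH].
  by apply: eq_smooth_on (smooth_on_cst 0) => y _; rewrite big_nil.
apply: eq_smooth_on (smooth_on_lin 1 (h i) IH) => y _.
by rewrite big_cons mul1r.
Qed.

Lemma smooth_on_partial i F : smooth_on U F -> smooth_on U (partial i F).
Proof. by move=> h s x Ux; have := h (rcons s i) x Ux; rewrite foldr_rcons. Qed.

(** [smooth_on] iterates coordinate partials only; any other direction is a linear combination of
    them. *)
Lemma smooth_dd v F : smooth_on U F -> smooth_on U (dd v F).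
Proof.
move=> h; apply: (@eq_smooth_on (fun y => \sum_i v 0 i * partial i F y)).
  move=> y Uy; rewrite dd_partial; last exact: smooth_dfr.
  by apply: eq_bigr => i _; rewrite partialE.
apply: smooth_on_sum => i.
apply: eq_smooth_on (smooth_on_lin (v 0 i) (smooth_on_partial i h)
  (smooth_on_cst 0)) => y _.
by rewrite addr0.
Qed.

Lemma smooth_dd_swap v w F x : smooth_on U F -> U x ->
  dd w (dd v F) x = dd v (dd w F) x.
Proof.
move=> h Ux; apply: (dd_swap oU Ux).
- by move=> y; exact: smooth_dfr.
- by apply: smooth_dfr Ux; exact: smooth_dd.
- by apply: smooth_dfr Ux; exact: smooth_dd.
Qed.

Lemma smooth_vect_cst k (a : 'rV[R]_k) : smooth_vect_on U (fun=> a).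
Proof. by move=> l; exact: smooth_on_cst. Qed.

End Smooth.

(** * Derivatives on a product of two coordinate spaces *)

Section Product.
Context (R : realType) (n : nat).
Implicit Types (a b v w : 'rV[R]_n) (F : 'rV[R]_(n + n) -> R).

Lemma dvec_row_mx m (f g : 'rV[R]_m -> 'rV[R]_n)
    (x u : 'rV[R]_m) :
  dvec u (fun y => row_mx (f y) (g y)) x = row_mx (dvec u f x) (dvec u g x).
Proof.
apply/rowP => k; rewrite -(fintype.splitK k); case: (fintype.split k) => j /=.
  rewrite row_mxEl !mxE; congr dd; apply/funext => y; exact: row_mxEl.
rewrite row_mxEr !mxE; congr dd; apply/funext => y; exact: row_mxEr.
Qed.

Lemma dvec_id v x : dvec v id x = v.
Proof.
have hd : derivable (@id 'rV[R]_n) x v by exact: derivable_id.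
by apply/rowP => k; rewrite -[in RHS](derive_id x v) derive_mx// !mxE ddE.
Qed.

Lemma dfr_row_mx m (f g : 'rV[R]_m -> 'rV[R]_n)
    (x : 'rV[R]_m) k :
  (forall l, dfr (fun y => f y 0 l) x) -> (forall l, dfr (fun y => g y 0 l) x) ->
  dfr (fun y => row_mx (f y) (g y) 0 k) x.
Proof.
move=> hf hg; rewrite -(fintype.splitK k); case: (fintype.split k) => j /=.
  by under [X in dfr X]eq_fun do rewrite row_mxEl.
by under [X in dfr X]eq_fun do rewrite row_mxEr.
Qed.

Lemma dd_row_mxl F a b v : dfr F (row_mx a b) ->
  dd v (fun y => F (row_mx y b)) a = dd (row_mx v 0) F (row_mx a b).
Proof.
move=> h; rewrite (@dd_comp _ _ _ (fun y => row_mx y b))//.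
  by rewrite dvec_row_mx dvec_id dvec_cst.
by move=> l; apply: dfr_row_mx => j; [exact: dfr_coord|exact: dfr_cst].
Qed.

Lemma dd_row_mxr F a b v : dfr F (row_mx a b) ->
  dd v (fun y => F (row_mx a y)) b = dd (row_mx 0 v) F (row_mx a b).
Proof.
move=> h; rewrite (@dd_comp _ _ _ (fun y => row_mx a y))//.
  by rewrite dvec_row_mx dvec_id dvec_cst.
by move=> l; apply: dfr_row_mx => j; [exact: dfr_cst|exact: dfr_coord].
Qed.
End Product.

Notation inL v := (row_mx v 0) (only parsing).
Notation inR v := (row_mx 0 v) (only parsing).

(** * The metric h of a cost and its Levi-Civita connection *)

Section CostMetric.
Context (R : realType) (n : nat) (A B : set 'rV[R]_n).
Context (C : 'rV[R]_(n + n) -> R).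
Hypothesis (oA : open A) (oB : open B).
Let U : set 'rV[R]_(n + n) := [set z | A (lsubmx z) /\ B (rsubmx z)].
Hypothesis sC : smooth_on U C.
Implicit Types (a b s v w : 'rV[R]_n) (X Y Z z : 'rV[R]_(n + n)).

Lemma open_product : open U.
Proof.
have -> : U = (lsubmx @^-1` A) `&` (rsubmx @^-1` B) by [].
apply: openI; apply: open_comp => // z _; apply: differentiable_continuous.
  exact: differentiable_lsubmx.
exact: differentiable_rsubmx.
Qed.
Let oU := open_product.

Definition mixed_mx z : 'M[R]_n :=
  \matrix_(i, j) dd (inL (delta_mx 0 i)) (dd (inR (delta_mx 0 j)) C) z.

(** [h_metric] with the polarization worked out: the squares have cancelled and the two cross terms
    are left. *)
Definition polar_metric z X Y : R :=
  - (bil (mixed_mx z) (lsubmx X) (rsubmx Y) +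
     bil (mixed_mx z) (lsubmx Y) (rsubmx X)) / 2.

Let Q := mixed_mx.
Let h := polar_metric.

Lemma inL_sum v : inL v = \sum_i v 0 i *: inL (delta_mx 0 i) :> 'rV[R]_(n + n).
Proof.
rewrite [in LHS](row_sum_delta v).
elim/big_rec2 : _ => [|i x y _ <-]; first exact: row_mx0.
by rewrite scale_row_mx add_row_mx scaler0 add0r.
Qed.

Lemma inR_sum v : inR v = \sum_i v 0 i *: inR (delta_mx 0 i) :> 'rV[R]_(n + n).
Proof.
rewrite [in LHS](row_sum_delta v).
elim/big_rec2 : _ => [|i x y _ <-]; first exact: row_mx0.
by rewrite scale_row_mx add_row_mx scaler0 add0r.
Qed.

Let sdd X : smooth_on U (dd X C). Proof. exact: smooth_dd. Qed.
Let sdd2 X Y : smooth_on U (dd X (dd Y C)).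
Proof. by apply: smooth_dd. Qed.
Let dC z : U z -> dfr C z. Proof. exact: smooth_dfr. Qed.
Let ddC X z : U z -> dfr (dd X C) z.
Proof. by move=> Uz; apply: smooth_dfr (sdd X) Uz. Qed.
Let dddC X Y z : U z -> dfr (dd X (dd Y C)) z.
Proof. by move=> Uz; apply: smooth_dfr (sdd2 X Y) Uz. Qed.

(** Makes [h] a sum of second derivatives of the cost in arbitrary directions, so that its
    derivatives are third derivatives whose order can be permuted. *)
Lemma bil_mixed z a b : U z -> bil (Q z) a b = dd (inL a) (dd (inR b) C) z.
Proof.
move=> Uz.
have e y : U y -> dd (inR b) C y = \sum_j b 0 j * dd (inR (delta_mx 0 j)) C y.
  move=> Uy; rewrite inR_sum dd_sumv; last exact: dC.
  by apply: eq_bigr => j _; rewrite ddZv//; exact: dC.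
rewrite (eq_dd _ oU Uz e) inL_sum dd_sumv; last first.
  by apply: dfr_sum => j; apply: dfrM; [exact: dfr_cst|exact: ddC].
apply: eq_bigr => i _; rewrite ddZv; last first.
  by apply: dfr_sum => j; apply: dfrM; [exact: dfr_cst|exact: ddC].
rewrite dd_sum; last by move=> j; apply: dfrM; [exact: dfr_cst|exact: ddC].
rewrite mulr_sumr; apply: eq_bigr => j _; rewrite ddMl; last exact: ddC.
by rewrite mxE; ring.
Qed.

Lemma polarC z X Y : h z X Y = h z Y X.
Proof. by rewrite /h /polar_metric addrC. Qed.

(** T M' is null for [h], so a vector (0, s) tests the M-part of X alone. *)
Lemma polar_inR z X s : h z X (inR s) = - bil (Q z) (lsubmx X) s / 2.
Proof. by rewrite /h /polar_metric row_mxKl row_mxKr bil0l addr0. Qed.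

Lemma polar_inL z X s : h z X (inL s) = - bil (Q z) s (rsubmx X) / 2.
Proof. by rewrite /h /polar_metric row_mxKl row_mxKr bil0r add0r. Qed.

Lemma polar_split z X Y :
  h z X Y = h z X (inL (lsubmx Y)) + h z X (inR (rsubmx Y)).
Proof. by rewrite polar_inL polar_inR /h /polar_metric; lra. Qed.

(** A Gram matrix of [h], through which the duality results on [bil] apply to it. *)
Definition polar_mx z : 'M[R]_(n + n) :=
  \matrix_(i, j) h z (delta_mx 0 i) (delta_mx 0 j).

Lemma polarDl z X Y Z : h z (X + Y) Z = h z X Z + h z Y Z.
Proof. by rewrite /h /polar_metric !linearD /= bilDl bilDr; lra. Qed.

Lemma polarZl z (t : R) X Z : h z (t *: X) Z = t * h z X Z.
Proof. by rewrite /h /polar_metric !linearZ /= bilZl bilZr; lra. Qed.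

Lemma polar_suml z (I : Type) (r : seq I) (X : I -> 'rV[R]_(n + n)) Z :
  h z (\sum_(i <- r) X i) Z = \sum_(i <- r) h z (X i) Z.
Proof.
elim: r => [|i r IH]; last by rewrite !big_cons polarDl IH.
by rewrite !big_nil -(scale0r 0) polarZl mul0r.
Qed.

Lemma bil_polar_mx z X Y : bil (polar_mx z) X Y = h z X Y.
Proof.
rewrite [in RHS](row_sum_delta X) polar_suml; apply: eq_bigr => i _.
rewrite polarZl polarC [in RHS](row_sum_delta Y) polar_suml mulr_sumr.
by apply: eq_bigr => j _; rewrite polarZl polarC mxE; ring.
Qed.

Lemma dd_inLR X F z : dfr F z ->
  dd X F z = dd (inL (lsubmx X)) F z + dd (inR (rsubmx X)) F z.
Proof.
move=> hF; rewrite -ddDv// -[X in dd X](hsubmxK X).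
by rewrite add_row_mx addr0 add0r.
Qed.

Lemma dd3_swap12 X Y Z z : U z ->
  dd X (dd Y (dd Z C)) z = dd Y (dd X (dd Z C)) z.
Proof. by move=> Uz; apply: (smooth_dd_swap oU _ _ (sdd Z) Uz). Qed.

Lemma dd3_swap23 X Y Z z : U z ->
  dd X (dd Y (dd Z C)) z = dd X (dd Z (dd Y C)) z.
Proof.
by move=> Uz; apply: eq_dd oU Uz _ => y; exact: (smooth_dd_swap oU).
Qed.

Lemma dfr_polar z X Y : U z -> dfr (fun y => h y X Y) z.
Proof.
move=> Uz; apply: dfrM; last exact: dfr_cst.
apply: dfrN; apply: dfrD.
  apply: (eq_dfr oU Uz) (dddC (inL (lsubmx X)) (inR (rsubmx Y)) Uz) => y Uy.
  by rewrite bil_mixed.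
apply: (eq_dfr oU Uz) (dddC (inL (lsubmx Y)) (inR (rsubmx X)) Uz) => y Uy.
by rewrite bil_mixed.
Qed.

Lemma dd_polar W z X Y : U z -> dd W (fun y => h y X Y) z =
  - (dd W (dd (inL (lsubmx X)) (dd (inR (rsubmx Y)) C)) z +
     dd W (dd (inL (lsubmx Y)) (dd (inR (rsubmx X)) C)) z) / 2.
Proof.
move=> Uz.
have e y : U y -> h y X Y = - (dd (inL (lsubmx X)) (dd (inR (rsubmx Y)) C) y +
     dd (inL (lsubmx Y)) (dd (inR (rsubmx X)) C) y) / 2.
  by move=> Uy; rewrite /h /polar_metric !bil_mixed.
rewrite (eq_dd _ oU Uz e) ddMr ?ddN ?ddD//; try exact: dddC.
  by apply: dfrD; exact: dddC.
by apply: dfrN; apply: dfrD; exact: dddC.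
Qed.

Context (Gamma : christoffel R (n + n)).
Hypothesis dGamma : forall z i j k, U z -> dfr (fun y => Gamma y i j k) z.
Hypothesis compat : forall z X Y Z, U z -> dd X (fun y => h y Y Z) z =
  h z (bilc Gamma z X Y) Z + h z Y (bilc Gamma z X Z).
Hypothesis torsion_free : forall z X Y, U z ->
  bilc Gamma z X Y = bilc Gamma z Y X.

(** Brackets of constant fields vanish, so only the three derivatives of the metric occur. *)
Lemma koszul z X Y Z : U z -> 2 * h z (bilc Gamma z X Y) Z =
  dd X (fun y => h y Y Z) z + dd Y (fun y => h y X Z) z -
  dd Z (fun y => h y X Y) z.
Proof.
move=> Uz; rewrite !compat// (torsion_free Y X Uz) (torsion_free Z X Uz).
rewrite (torsion_free Z Y Uz) (polarC z _ (bilc Gamma z X Z)).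
move: (h z (bilc Gamma z X Z) Y) (h z X _) (h z _ _).
by move=> p q r; lra.
Qed.

Lemma dd0_fun F : dd 0 F = (fun=> 0) :> ('rV[R]_(n + n) -> R).
Proof. by apply/funext => y; exact: dd0v. Qed.

Lemma dd3_rev X Y Z z : U z ->
  dd X (dd Y (dd Z C)) z = dd Z (dd Y (dd X C)) z.
Proof. by move=> Uz; rewrite dd3_swap12// dd3_swap23// dd3_swap12. Qed.

(** With (0, s) as third vector every term is a third derivative of [C]. Once X and Y are split, the
    terms using one of them in M and the other in M' cancel against the derivative of h(X, Y) along
    (0, s); two copies of the pure M term remain. *)
Lemma koszul_left z X Y s : U z ->
  bil (Q z) (lsubmx (bilc Gamma z X Y)) s =
  dd (inL (lsubmx X)) (dd (inL (lsubmx Y)) (dd (inR s) C)) z.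
Proof.
move=> Uz; have := koszul X Y (inR s) Uz.
rewrite polar_inR !dd_polar// !row_mxKl !row_mxKr row_mx0 !dd0_fun !dd_cst.
rewrite (dd_inLR X (dddC _ _ Uz)) (dd_inLR Y (dddC _ _ Uz)).
rewrite (dd3_swap12 (inL (lsubmx Y)) (inL (lsubmx X)))//.
rewrite (dd3_rev (inR s) (inL (lsubmx X)))// (dd3_rev (inR s) (inL (lsubmx Y)))//.
move: (bil _ _ _) (dd _ _ _) (dd _ _ _) (dd _ _ _).
by move=> p q r t; lra.
Qed.

Lemma koszul_right z X Y s : U z ->
  bil (Q z) s (rsubmx (bilc Gamma z X Y)) =
  dd (inR (rsubmx X)) (dd (inR (rsubmx Y)) (dd (inL s) C)) z.
Proof.
move=> Uz; have := koszul X Y (inL s) Uz.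
rewrite polar_inL !dd_polar// !row_mxKl !row_mxKr row_mx0 !dd0_fun.
have e0 v : dd (inL v) (fun=> 0) = (fun=> 0 : R) :> ('rV[R]_(n + n) -> R).
  by apply/funext => y; rewrite dd_cst.
rewrite !e0 !dd_cst (dd_inLR X (dddC _ _ Uz)) (dd_inLR Y (dddC _ _ Uz)).
rewrite (dd3_swap12 (inL s) (inL (lsubmx X)))//.
rewrite (dd3_swap12 (inL s) (inL (lsubmx Y)))//.
rewrite (dd3_swap23 (inR (rsubmx X)) (inL s))//.
rewrite (dd3_swap23 (inR (rsubmx Y)) (inL s))//.
rewrite (dd3_swap12 (inR (rsubmx Y)) (inR (rsubmx X)))//.
move: (bil _ _ _) (dd _ _ _) (dd _ _ _) (dd _ _ _).
by move=> p q r t; lra.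
Qed.

Hypothesis unitQ : forall z, U z -> Q z \in unitmx.

Lemma lsub_bilc z X Y : U z ->
  lsubmx (bilc Gamma z X Y) =
  lsubmx (bilc Gamma z (inL (lsubmx X)) (inL (lsubmx Y))).
Proof.
move=> Uz; apply/eqP; rewrite -subr_eq0; apply/eqP.
apply: (bil_unitl (unitQ Uz)) => s.
by rewrite bilDl bilNl !koszul_left// !row_mxKl subrr.
Qed.

(** By [koszul_right] the M'-part is a derivative along the M'-part of the second argument, here 0.
    Thus T M is parallel. *)
Lemma rsub_bilc_inL z X v : U z -> rsubmx (bilc Gamma z X (inL v)) = 0.
Proof.
move=> Uz; apply: (bil_unitr (unitQ Uz)) => s.
by rewrite koszul_right// row_mxKr row_mx0 dd0_fun dd_cst.
Qed.

(** Curvature preserves a parallel subbundle: in each [cov] the differentiated coordinate vanishes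
    on all of U, and the vector fed to [Gamma] is again of the form (a, 0). *)
Lemma rsub_curv_inL z X Y v : U z -> rsubmx (curv Gamma z X Y (inL v)) = 0.
Proof.
move=> Uz; apply/rowP => k.
have hr W a y : U y -> bilc Gamma y W (inL a) 0 (rshift n k) = 0.
  by move=> Uy; have /rowP/(_ k) := rsub_bilc_inL W a Uy; rewrite [LHS]mxE [RHS]mxE.
have hc W T : cov Gamma W (fun y => bilc Gamma y T (inL v)) z 0 (rshift n k) = 0.
  rewrite mxE [dvec _ _ _ _ _]mxE (eq_dd W oU Uz (hr T v)) dd_cst add0r.
  by rewrite -[bilc Gamma z T (inL v)]hsubmxK rsub_bilc_inL// hr.
by rewrite [LHS]mxE [RHS]mxE /curv [LHS]mxE [X in _ + X]mxE !hc subrr.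
Qed.

Lemma polar_curv z X Y : U z -> h z (curv Gamma z X Y Y) X =
  1 / 2 * (bil (Q z) (lsubmx (curv Gamma z X Y (inL (lsubmx X)))) (rsubmx Y) -
           bil (Q z) (lsubmx (curv Gamma z X Y Y)) (rsubmx X)).
Proof.
move=> Uz; rewrite polar_split polar_inR.
have hG y i j : U y -> dfr (fun y => polar_mx y i j) y.
  move=> Uy; under [X in dfr X]eq_fun do rewrite mxE; exact: dfr_polar.
have hd y W Z T : U y -> dd W (fun y => bil (polar_mx y) Z T) y =
    bil (polar_mx y) (bilc Gamma y W Z) T + bil (polar_mx y) Z (bilc Gamma y W T).
  move=> Uy; rewrite !bil_polar_mx -compat//; congr dd; apply/funext => t.
  by rewrite bil_polar_mx.
(* Metric compatibility makes [Gamma] its own dual, so duality of curvatures becomes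
   skew-symmetry. *)
have := dual_curv oU hG dGamma dGamma hd X Y Y (inL (lsubmx X)) Uz.
rewrite !bil_polar_mx => ->.
(* The vanishing M'-part of the curvature kills one of the two cross terms. *)
rewrite [h z Y _]/h /polar_metric rsub_curv_inL// bil0r add0r.
by move: (bil _ _ _) (bil _ _ _) => p q; lra.
Qed.
End CostMetric.

(** * Inverse matrices, raised indices and the first-order condition at a minimum *)

Section MatrixCalculus.
Context (R : realType) (m : nat).

Lemma dfr_prod (I : Type) (r : seq I) (F : I -> 'rV[R]_m -> R) x :
  (forall i, dfr (F i) x) -> dfr (fun y => \prod_(i <- r) F i y) x.
Proof.
move=> h; elim: r => [|i r IH].
  by under [X in dfr X]eq_fun do rewrite big_nil; exact: dfr_cst.
by under [X in dfr X]eq_fun do rewrite big_cons; exact: dfrM.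
Qed.

Lemma dfr_det k (M : 'rV[R]_m -> 'M[R]_k) x :
  (forall i j, dfr (fun y => M y i j) x) -> dfr (fun y => \det (M y)) x.
Proof.
move=> h; apply: dfr_sum => s; apply: dfrM; first exact: dfr_cst.
by apply: dfr_prod => i.
Qed.

Lemma dfrV (F : 'rV[R]_m -> R) x : dfr F x -> F x != 0 ->
  dfr (fun y => (F y)^-1) x.
Proof. exact: differentiableV. Qed.

(** On V the inverse is the adjugate over the determinant, a rational expression in the entries. *)
Lemma dfr_invmx k (V : set 'rV[R]_m) (M : 'rV[R]_m -> 'M[R]_k) x i j :
  open V -> V x -> (forall y, V y -> M y \in unitmx) ->
  (forall i j, dfr (fun y => M y i j) x) -> dfr (fun y => invmx (M y) i j) x.
Proof.
move=> oV Vx uM h.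
apply: (@eq_dfr _ _ V (fun y => (\det (M y))^-1 * cofactor (M y) j i)) => //.
  by move=> y Vy; rewrite /invmx (uM _ Vy) !mxE.
apply: dfrM.
  apply: dfrV; first exact: dfr_det.
  by have := uM _ Vx; rewrite unitmxE unitfE.
apply: dfrM; first exact: dfr_cst.
by apply: dfr_det => a b; under [X in dfr X]eq_fun do rewrite !mxE.
Qed.

Lemma unitmx_ker k (M : 'M[R]_k) :
  (forall v : 'rV[R]_k, v *m M = 0 -> v = 0) -> M \in unitmx.
Proof.
move=> h; rewrite -row_free_unit -kermx_eq0; apply/eqP/row_matrixP => i.
by rewrite row0; apply: h; rewrite -row_mul mulmx_ker row0.
Qed.

Lemma bil_mul k (M : 'M[R]_k) v w : bil M v w = \sum_j (v *m M) 0 j * w 0 j.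
Proof.
rewrite /bil exchange_big; apply: eq_bigr => j _; rewrite mxE mulr_suml.
by apply: eq_bigr => i _; ring.
Qed.

(** Pairing with the metric cancels the inverse matrix in [raise_index], so the connections can be
    handled through their lowered symbols. *)
Lemma bil_raise k (Div : 'rV[R]_k -> 'rV[R]_k -> R) Gl x v w s :
  div_metric_mx Div x \in unitmx ->
  bil (div_metric_mx Div x) (bilc (raise_index Div Gl) x v w) s =
  \sum_i \sum_j \sum_l v 0 i * w 0 j * s 0 l * Gl x i j l.
Proof.
move=> ug; pose L := \row_l \sum_i \sum_j v 0 i * w 0 j * Gl x i j l.
have -> : bilc (raise_index Div Gl) x v w = L *m invmx (div_metric_mx Div x).
  apply/rowP => l; rewrite bilcE !mxE.
  under [RHS]eq_bigr => p _ do rewrite mxE mulr_suml.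
  rewrite [RHS]exchange_big; apply: eq_bigr => i _.
  under [RHS]eq_bigr => p _ do rewrite mulr_suml.
  rewrite [RHS]exchange_big; apply: eq_bigr => j _.
  by rewrite mulr_sumr; apply: eq_bigr => p _; rewrite mulrA.
rewrite bil_mul mulmxKV//.
under eq_bigr => l _ do rewrite mxE mulr_suml.
rewrite exchange_big; apply: eq_bigr => i _.
under eq_bigr => l _ do rewrite mulr_suml.
rewrite exchange_big; apply: eq_bigr => j _.
by apply: eq_bigr => l _; ring.
Qed.

Lemma dd_min (U : set 'rV[R]_m) (F : 'rV[R]_m -> R) x v :
  open U -> U x -> (forall y, U y -> dfr F y) ->
  (forall y, U y -> F x <= F y) -> dd v F x = 0.
Proof.
move=> oU Ux hF hmin.
have /nbhs_rowP[d d0 hd] : nbhs x U by exact: open_nbhs_nbhs.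
(* For |t| < e the point x + t v stays within d of x; the added 1 covers v = 0. *)
pose e := d / (`|v| + 1).
have k0 : 0 < `|v| + 1 by rewrite ltr_wpDl.
have e0 : 0 < e by rewrite divr_gt0.
have inU t : t \in `](- e), e[%R -> U (x + t *: v).
  rewrite in_itv /= -ltr_norml => te; apply: hd; rewrite addrC addKr.
  have -> : `|t *: v| = `|t| * `|v| by exact: normrZ.
  apply: (@le_lt_trans _ _ (`|t| * (`|v| + 1))); last by rewrite -ltr_pdivlMr.
  by rewrite ler_wpM2l// lerDl.
have e1 : (0 : R) \in `](- e), e[%R by rewrite in_itv /= oppr_lt0 e0.
have : is_derive (0 : R) (1 : R) (fun t => F (x + t *: v)) 0.
  apply: (@derive1_at_min R _ (- e) e) => //.
  - by rewrite ge0_cp// ltW.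
  - by move=> t /inU Ut; have [] := is_derive_line (hF _ Ut).
  - by move=> t /inU Ut; rewrite scale0r addr0; exact: hmin.
have H := is_derive_line (hF _ (inU _ e1)).
case=> _; case: H => _; rewrite scale0r addr0 => -> //.
Qed.

End MatrixCalculus.

(** * The graph of F in coordinates, [kap] standing for minus the c-transform along F *)

Section Graph.
Context (R : realType) (n : nat) (A B : set 'rV[R]_n).
Context (C : 'rV[R]_(n + n) -> R).
Hypothesis (oA : open A) (oB : open B).
Let U : set 'rV[R]_(n + n) := [set z | A (lsubmx z) /\ B (rsubmx z)].
Hypothesis sC : smooth_on U C.
Context (V : set 'rV[R]_n) (F : 'rV[R]_n -> 'rV[R]_n).
Hypothesis (oV : open V) (VA : V `<=` A) (FB : forall b, V b -> B (F b)).
Hypothesis sF : smooth_vect_on V F.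
Context (Phi kap : 'rV[R]_n -> R) (Div : 'rV[R]_n -> 'rV[R]_n -> R).
Hypothesis DivE : forall a b, A a -> V b ->
  Div a b = C (row_mx a (F b)) - Phi a + kap b.
Hypothesis sPhi : smooth_on A Phi.
Hypothesis dkap : forall b, V b -> dfr kap b.
Hypothesis Div_ge0 : forall a b, A a -> V b -> 0 <= Div a b.
Hypothesis Div_diag : forall a, V a -> Div a a = 0.
Hypothesis injT : forall x v, V x -> dvec v F x = 0 -> v = 0.
Let Q := mixed_mx C.
Hypothesis unitQ : forall z, U z -> Q z \in unitmx.

Implicit Types (a b s v w x : 'rV[R]_n) (S : 'rV[R]_(n + n) -> R).

Let oU : open U := open_product oA oB.
Let e i : 'rV[R]_n := delta_mx 0 i.
Let gam a := row_mx a (F a).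
Let g := div_metric_mx Div.

Let U_pt a b : A a -> V b -> U (row_mx a (F b)).
Proof. by move=> Aa Vb; rewrite /U /= row_mxKl row_mxKr; split => //; exact: FB. Qed.

Let U_gam a : V a -> U (gam a).
Proof. by move=> Va; apply: U_pt => //; exact: VA. Qed.

Let dF l b : V b -> dfr (fun y => F y 0 l) b.
Proof. by move=> Vb; apply: smooth_dfr Vb; exact: sF. Qed.

Let ddF v l b : V b -> dfr (dd v (fun y => F y 0 l)) b.
Proof. by move=> Vb; apply: smooth_dfr Vb; exact: smooth_dd. Qed.

Let dddF v w l b : V b -> dfr (dd v (dd w (fun y => F y 0 l))) b.
Proof.
by move=> Vb; apply: smooth_dfr Vb; apply: smooth_dd => //; exact: smooth_dd.
Qed.

Lemma dd_inR w S z : dfr S z ->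
  dd (row_mx 0 w) S z = \sum_l w 0 l * dd (row_mx 0 (e l)) S z.
Proof.
move=> hS; rewrite inR_sum dd_sumv//.
by apply: eq_bigr => l _; rewrite ddZv.
Qed.

Lemma dfr_graphr S a b : dfr S (row_mx a (F b)) -> V b ->
  dfr (fun y => S (row_mx a (F y))) b.
Proof.
move=> hS Vb; apply: (@dfr_comp _ _ _ (fun y => row_mx a (F y))) => // l.
by apply: dfr_row_mx => k; [exact: dfr_cst|exact: dF].
Qed.

Lemma dd_graphr v S a b : dfr S (row_mx a (F b)) -> V b ->
  dd v (fun y => S (row_mx a (F y))) b =
  dd (row_mx 0 (dvec v F b)) S (row_mx a (F b)).
Proof.
move=> hS Vb; rewrite (@dd_comp _ _ _ (fun y => row_mx a (F y)))//.
  by rewrite dvec_row_mx dvec_cst.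
by move=> l; apply: dfr_row_mx => k; [exact: dfr_cst|exact: dF].
Qed.

Lemma dfr_gam S a : dfr S (gam a) -> V a -> dfr (fun y => S (gam y)) a.
Proof.
move=> hS Va; apply: dfr_comp => // l.
by apply: dfr_row_mx => k; [exact: dfr_coord|exact: dF].
Qed.

Lemma dd_gam v S a : dfr S (gam a) -> V a ->
  dd v (fun y => S (gam y)) a = dd (row_mx v (dvec v F a)) S (gam a).
Proof.
move=> hS Va; rewrite dd_comp//; first by rewrite dvec_row_mx dvec_id.
by move=> l; apply: dfr_row_mx => k; [exact: dfr_coord|exact: dF].
Qed.

Lemma dfr_graphl S a b : dfr S (row_mx a b) -> dfr (fun y => S (row_mx y b)) a.
Proof.
move=> hS; apply: (@dfr_comp _ _ _ (fun y => row_mx y b)) => // l.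
by apply: dfr_row_mx => k; [exact: dfr_coord|exact: dfr_cst].
Qed.

Let dC z : U z -> dfr C z. Proof. exact: smooth_dfr. Qed.
Let sdC X : smooth_on U (dd X C). Proof. exact: smooth_dd. Qed.
Let ddC X z : U z -> dfr (dd X C) z.
Proof. by move=> Uz; apply: smooth_dfr (sdC X) Uz. Qed.
Let sddC X Y : smooth_on U (dd X (dd Y C)). Proof. exact: smooth_dd. Qed.
Let dddC X Y z : U z -> dfr (dd X (dd Y C)) z.
Proof. by move=> Uz; apply: smooth_dfr (sddC X Y) Uz. Qed.
Let ddddC X Y Z z : U z -> dfr (dd X (dd Y (dd Z C))) z.
Proof. by move=> Uz; apply: smooth_dfr Uz; apply: smooth_dd. Qed.

(* On the diagonal this is g_{kj}; differentiating in its first or second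
   argument gives the Christoffel symbols of nabla and nabla^* respectively. *)
Definition mixed_div (k j : 'I_n) a b : R :=
  - \sum_l dd (e j) (fun y => F y 0 l) b *
     dd (row_mx (e k) 0) (dd (row_mx 0 (e l)) C) (row_mx a (F b)).

Let P := mixed_div.

Lemma partial_right j a b : A a -> V b ->
  partial j (fun y => Div a y) b =
  \sum_l dd (e j) (fun y => F y 0 l) b * dd (row_mx 0 (e l)) C (row_mx a (F b)) +
  dd (e j) kap b.
Proof.
move=> Aa Vb; rewrite partialE (eq_dd _ oV Vb (fun y Vy => DivE Aa Vy)).
have h1 : dfr (fun y => C (row_mx a (F y))) b.
  by apply: dfr_graphr => //; exact: dC (U_pt Aa Vb).
rewrite ddD; [|by apply: dfrB => //; exact: dfr_cst|exact: dkap].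
rewrite ddB//.
rewrite dd_cst subr0 dd_graphr//; last exact: dC (U_pt Aa Vb).
rewrite dd_inR; last exact: dC (U_pt Aa Vb).
by congr (_ + _); apply: eq_bigr => l _; rewrite mxE.
Qed.

Lemma partial_left k a b : A a -> V b ->
  partial k (fun y => Div y b) a =
  dd (row_mx (e k) 0) C (row_mx a (F b)) - dd (e k) Phi a.
Proof.
move=> Aa Vb; rewrite partialE (eq_dd _ oA Aa (fun y Ay => DivE Ay Vb)).
have h1 : dfr (fun y => C (row_mx y (F b))) a.
  by apply: dfr_graphl => //; exact: dC (U_pt Aa Vb).
have h2 : dfr Phi a by exact: smooth_dfr sPhi Aa.
rewrite ddD; [|by apply: dfrB|exact: dfr_cst].
rewrite ddB// dd_cst addr0 dd_row_mxl//; exact: dC (U_pt Aa Vb).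
Qed.

Lemma partial_left_right k j a b : A a -> V b ->
  partial k (fun y => partial j (fun t => Div y t) b) a = - P k j a b.
Proof.
move=> Aa Vb.
rewrite partialE (eq_dd _ oA Aa (fun y Ay => partial_right j Ay Vb)).
have h l : dfr (fun y => dd (row_mx 0 (e l)) C (row_mx y (F b))) a.
  by apply: dfr_graphl; exact: ddC (U_pt Aa Vb).
have h' l : dfr (fun y => dd (e j) (fun y => F y 0 l) b *
                  dd (row_mx 0 (e l)) C (row_mx y (F b))) a.
  by apply: dfrM => //; exact: dfr_cst.
rewrite ddD; [|exact: dfr_sum|exact: dfr_cst].
rewrite dd_cst addr0 dd_sum// /P /mixed_div opprK; apply: eq_bigr => l _.
rewrite ddMl// dd_row_mxl//; exact: ddC (U_pt Aa Vb).
Qed.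

(** [div_gamma_low] and [div_gamma_star_low] take their inner derivative in different slots of
    [Div], so both orders are computed. *)
Lemma partial_right_left k j a b : A a -> V b ->
  partial j (fun y => partial k (fun t => Div t y) a) b = - P k j a b.
Proof.
move=> Aa Vb.
rewrite partialE (eq_dd _ oV Vb (fun y Vy => partial_left k Aa Vy)).
have Uab := U_pt Aa Vb.
rewrite ddB; [|by apply: dfr_graphr => //; exact: ddC|exact: dfr_cst].
rewrite dd_cst subr0 dd_graphr//; last exact: ddC.
rewrite dd_inR; last exact: ddC.
rewrite /P /mixed_div opprK; apply: eq_bigr => l _.
by rewrite mxE (smooth_dd_swap oU).
Qed.

Lemma metricE x k j : V x -> g x k j = P k j x x.
Proof. by move=> Vx; rewrite mxE partial_left_right ?opprK//; exact: VA. Qed.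

Lemma gamma_lowE x i k j : V x ->
  div_gamma_low Div x i k j = - \sum_l dd (e j) (fun y => F y 0 l) x *
    dd (row_mx (e i) 0) (dd (row_mx (e k) 0) (dd (row_mx 0 (e l)) C)) (gam x).
Proof.
move=> Vx; have Ax := VA Vx; have Ux := U_pt Ax Vx.
rewrite /div_gamma_low partialE.
rewrite (eq_dd _ oA Ax (fun y Ay => partial_left_right k j Ay Vx)).
have h l : dfr (fun y => dd (row_mx (e k) 0) (dd (row_mx 0 (e l)) C)
    (row_mx y (F x))) x by apply: dfr_graphl; exact: dddC.
have h' l : dfr (fun y => dd (e j) (fun y => F y 0 l) x *
    dd (row_mx (e k) 0) (dd (row_mx 0 (e l)) C) (row_mx y (F x))) x.
  by apply: dfrM => //; exact: dfr_cst.
rewrite /P /mixed_div; under [X in dd _ X]eq_fun do rewrite opprK.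
rewrite dd_sum//; congr (- _); apply: eq_bigr => l _.
rewrite ddMl// dd_row_mxl//; exact: dddC.
Qed.

(** The second slot enters through F: the product rule brings second derivatives of F, the chain
    rule derivatives of the cost along dF. *)
Lemma gamma_star_lowE x i j k : V x ->
  div_gamma_star_low Div x i j k = - \sum_l
    (dd (e i) (dd (e j) (fun y => F y 0 l)) x *
       dd (row_mx (e k) 0) (dd (row_mx 0 (e l)) C) (gam x) +
     dd (e j) (fun y => F y 0 l) x * \sum_m dd (e i) (fun y => F y 0 m) x *
       dd (row_mx 0 (e m)) (dd (row_mx (e k) 0) (dd (row_mx 0 (e l)) C)) (gam x)).
Proof.
move=> Vx; have Ax := VA Vx; have Ux := U_pt Ax Vx.
rewrite /div_gamma_star_low partialE.
rewrite (eq_dd _ oV Vx (fun y Vy => partial_right_left k j Ax Vy)).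
have h l : dfr (fun y => dd (row_mx (e k) 0) (dd (row_mx 0 (e l)) C)
    (row_mx x (F y))) x by apply: dfr_graphr => //; exact: dddC.
have h' l : dfr (fun y => dd (e j) (fun y => F y 0 l) y *
    dd (row_mx (e k) 0) (dd (row_mx 0 (e l)) C) (row_mx x (F y))) x.
  by apply: dfrM => //; exact: ddF.
rewrite /P /mixed_div; under [X in dd _ X]eq_fun do rewrite opprK.
rewrite dd_sum//; congr (- _); apply: eq_bigr => l _.
rewrite ddM//; last exact: ddF.
rewrite dd_graphr//; last exact: dddC.
congr (_ + _ * _); rewrite dd_inR; last exact: dddC.
by apply: eq_bigr => m _; rewrite mxE.
Qed.

Lemma dfr_metric x k j : V x -> dfr (fun y => g y k j) x.
Proof.
move=> Vx; apply: (eq_dfr oV Vx (fun y Vy => esym (metricE k j Vy))).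
apply: dfrN; apply: dfr_sum => l; apply: dfrM; first exact: ddF.
apply: (@dfr_gam (dd (row_mx (e k) 0) (dd (row_mx 0 (e l)) C))) => //.
by apply: dddC; exact: U_gam.
Qed.

(** On the diagonal both arguments of [mixed_div] move; the first contributes the plain symbol, the
    second the starred one. This is the duality of the two connections in lowered form. *)
Lemma dd_metric x i k j : V x -> dd (e i) (fun y => g y k j) x =
  div_gamma_low Div x i k j + div_gamma_star_low Div x i j k.
Proof.
move=> Vx; have Ux := U_gam Vx.
rewrite (eq_dd _ oV Vx (fun y Vy => metricE k j Vy)).
rewrite gamma_lowE// gamma_star_lowE// -opprD -big_split /=.
have h l : dfr (fun y => dd (row_mx (e k) 0) (dd (row_mx 0 (e l)) C) (gam y)) x.
  by apply: dfr_gam => //; exact: dddC.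
have h' l : dfr (fun y => dd (e j) (fun y => F y 0 l) y *
    dd (row_mx (e k) 0) (dd (row_mx 0 (e l)) C) (gam y)) x.
  by apply: dfrM => //; exact: ddF.
rewrite /P /mixed_div ddN; last exact: dfr_sum.
rewrite dd_sum//; congr (- _); apply: eq_bigr => l _.
rewrite ddM//; last exact: ddF.
rewrite dd_gam//; last exact: dddC.
rewrite (dd_inLR (row_mx (e i) _)) ?row_mxKl ?row_mxKr; last exact: dddC.
rewrite (dd_inR (dvec _ _ _)); last exact: dddC.
rewrite mulrDr addrCA; congr (_ + (_ + _ * _)).
by apply: eq_bigr => m _; rewrite mxE.
Qed.

Lemma dfr_gamma_low x i j k : V x -> dfr (fun y => div_gamma_low Div y i j k) x.
Proof.
move=> Vx; apply: (eq_dfr oV Vx (fun y Vy => esym (gamma_lowE i j k Vy))).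
apply: dfrN; apply: dfr_sum => l; apply: dfrM; first exact: ddF.
by apply: dfr_gam => //; apply: ddddC; exact: U_gam.
Qed.

Lemma dfr_gamma_star_low x i j k : V x ->
  dfr (fun y => div_gamma_star_low Div y i j k) x.
Proof.
move=> Vx; have Ux := U_gam Vx.
apply: (eq_dfr oV Vx (fun y Vy => esym (gamma_star_lowE i j k Vy))).
apply: dfrN; apply: dfr_sum => l; apply: dfrD; apply: dfrM.
- exact: dddF.
- by apply: dfr_gam => //; exact: dddC.
- exact: ddF.
- apply: dfr_sum => m; apply: dfrM; first exact: ddF.
  by apply: dfr_gam => //; exact: ddddC.
Qed.

(** A derivative of [Div] in its second slot is one of the cost along dF; this ties g to the ambient
    [Q]. *)
Lemma bil_metric x v w : V x ->
  bil (g x) v w = - bil (Q (gam x)) v (dvec w F x).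
Proof.
move=> Vx; rewrite /bil -sumrN; apply: eq_bigr => k _.
transitivity (- \sum_l \sum_j (mixed_mx C (gam x) k l * v 0 k * w 0 j *
    dd (e j) (fun y => F y 0 l) x)); last first.
  congr (- _); apply: eq_bigr => l _; rewrite [dvec _ _ _ _ _]mxE (dd_partial w); last exact: dF.
  by rewrite mulr_sumr; apply: eq_bigr => j _; rewrite mulrA.
rewrite exchange_big -sumrN; apply: eq_bigr => j _.
rewrite metricE// /P /mixed_div !mulNr !mulr_suml; congr (- _).
by apply: eq_bigr => l _; rewrite [mixed_mx _ _ _ _]mxE -/(e _); ring.
Qed.

(* Div >= 0 vanishes on the diagonal, so its first-order condition there
   identifies the cost gradient along the graph with the gradient of Phi. *)
Lemma dd_cost_gam x v : V x -> dd (row_mx v 0) C (gam x) = dd v Phi x.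
Proof.
move=> Vx; have Ax := VA Vx; have Ux := U_gam Vx.
have h1 a : A a -> dfr (fun y => C (row_mx y (F x))) a.
  by move=> Aa; apply: dfr_graphl; exact: dC (U_pt Aa Vx).
have h2 a : A a -> dfr (fun y => Div y x) a.
  move=> Aa; apply: (eq_dfr oA Aa (fun y Ay => esym (DivE Ay Vx))).
  apply: dfrD; last exact: dfr_cst.
  by apply: dfrB; [exact: h1|exact: smooth_dfr sPhi Aa].
have : dd v (fun y => Div y x) x = 0.
  apply: (@dd_min _ _ A (fun y => Div y x) x v oA Ax) => // y Ay.
  rewrite Div_diag//; exact: Div_ge0.
rewrite (eq_dd _ oA Ax (fun y Ay => DivE Ay Vx)).
have dPhi : dfr Phi x by exact: smooth_dfr sPhi Ax.
rewrite ddD; [|by apply: dfrB => //; exact: h1|exact: dfr_cst].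
rewrite ddB//; last exact: h1.
rewrite dd_cst addr0 dd_row_mxl; last exact: dC.
by move=> /eqP; rewrite subr_eq0 => /eqP.
Qed.

(** Differentiating [dd_cost_gam] along the graph gives d_t d_s C + q(s, dF t) = d_t d_s Phi. The
    two second derivatives are symmetric in s and t, hence so is q(s, dF t). *)
Lemma metricC x v w : V x -> bil (g x) v w = bil (g x) w v.
Proof.
move=> Vx; have Ax := VA Vx; have Ux := U_gam Vx.
have H s t : dd (row_mx t 0) (dd (row_mx s 0) C) (gam x) +
    bil (Q (gam x)) s (dvec t F x) = dd t (dd s Phi) x.
  rewrite -(eq_dd _ oV Vx (fun y Vy => dd_cost_gam s Vy)).
  rewrite dd_gam//; last exact: ddC.
  rewrite (dd_inLR (row_mx t (dvec t F x))) ?row_mxKl ?row_mxKr; last exact: ddC.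
  by rewrite (bil_mixed oA oB sC) // (smooth_dd_swap oU (row_mx s 0) (row_mx 0 _) sC Ux).
rewrite !bil_metric//; congr (- _).
have := H v w; have := H w v.
rewrite (smooth_dd_swap oA v w sPhi Ax) => <-.
by rewrite (smooth_dd_swap oU _ _ sC Ux) => /addrI ->.
Qed.

(** For v in the kernel, symmetry gives q(s, dF v) = 0 for all s; then dF v = 0 as q is
    non-degenerate, and v = 0 as F is an immersion. *)
Lemma metric_unit x : V x -> g x \in unitmx.
Proof.
move=> Vx; apply: unitmx_ker => v hv; apply: (injT Vx).
apply: (bil_unitr (unitQ (U_gam Vx))) => s.
apply: oppr_inj; rewrite -bil_metric// metricC// bil_mul hv oppr0 big1// => j _.
by rewrite mxE mul0r.
Qed.

Let nab := raise_index Div (div_gamma_low Div).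
Let nab' := raise_index Div (div_gamma_star_low Div).

Lemma dfr_raise Gl x i j k : (forall i j k, dfr (fun y => Gl y i j k) x) ->
  V x -> dfr (fun y => raise_index Div Gl y i j k) x.
Proof.
move=> h Vx; apply: dfr_sum => m; apply: dfrM => //.
by apply: (dfr_invmx (V := V)) => // [y Vy|a b]; [exact: metric_unit|exact: dfr_metric].
Qed.

Lemma dual_nabla x v z w : V x -> dd v (fun y => bil (g y) z w) x =
  bil (g x) (bilc nab x v z) w + bil (g x) z (bilc nab' x v w).
Proof.
move=> Vx.
(* [bil_raise] wants the connection in the first argument of the metric. What follows contracts
   [dd_metric] with v, z and w. *)
rewrite [X in _ = _ + X](metricC z (bilc nab' x v w) Vx).
rewrite [X in _ = X + _](bil_raise (div_gamma_low Div) v z w (metric_unit Vx)).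
rewrite [X in _ = _ + X](bil_raise (div_gamma_star_low Div) v w z (metric_unit Vx)).
have h i j : dfr (fun y => g y i j * z 0 i * w 0 j) x.
  by do 2?apply: dfrM; [exact: dfr_metric|exact: dfr_cst|exact: dfr_cst].
rewrite /bil dd_sum; last by move=> i; exact: dfr_sum.
under eq_bigr => i _.
  rewrite dd_sum//; under eq_bigr => j _.
    rewrite ddMr; last by apply: dfrM; [exact: dfr_metric|exact: dfr_cst].
    rewrite ddMr; last exact: dfr_metric.
    rewrite dd_partial; last exact: dfr_metric.
    rewrite !mulr_suml; under eq_bigr => k _ do rewrite dd_metric//.
    over.
  over.
under eq_bigr => i _ do rewrite exchange_big.
rewrite exchange_big [X in _ = _ + X](_ : _ =
  \sum_k \sum_i \sum_j v 0 k * w 0 j * z 0 i * div_gamma_star_low Div x k j i).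
  rewrite -big_split; apply: eq_bigr => k _ /=.
  rewrite -big_split; apply: eq_bigr => i _ /=.
  rewrite -big_split; apply: eq_bigr => j _ /=.
  rewrite mulrDr !mulrDl; congr (_ + _).
    by rewrite [X in X * _ = _]mulrAC; exact: mulrAC.
  by rewrite mulrAC [X in X * _ = _]mulrAC; exact: mulrAC.
by apply: eq_bigr => k _; exact: exchange_big.
Qed.

Context (Gamma : christoffel R (n + n)).
Let h := polar_metric C.
Hypothesis dGamma : forall z i j k, U z -> dfr (fun y => Gamma y i j k) z.
Hypothesis compat : forall z X Y Z, U z -> dd X (fun y => h y Y Z) z =
  h z (bilc Gamma z X Y) Z + h z Y (bilc Gamma z X Z).
Hypothesis torsion_free : forall z X Y, U z ->
  bilc Gamma z X Y = bilc Gamma z Y X.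

(** The base point is frozen at z, so the connection on the right is constant and its argument 0 is
    a dummy. *)
Lemma lsub_bilc_inL z v w :
  lsubmx (bilc Gamma z (row_mx v 0) (row_mx w 0)) =
  bilc (fun _ i j k => Gamma z (lshift n i) (lshift n j) (lshift n k)) 0 v w.
Proof.
apply/rowP => k; rewrite mxE !bilcE big_split_ord /= [X in _ + X]big1 ?addr0.
  apply: eq_bigr => i _; rewrite big_split_ord /= [X in _ + X]big1 ?addr0.
    by apply: eq_bigr => j _; rewrite !row_mxEl.
  by move=> j _; rewrite row_mxEr [X in _ * X * _]mxE mulr0 mul0r.
by move=> i _; rewrite big1// => j _; rewrite row_mxEr [X in X * _ * _]mxE !mul0r.
Qed.

Lemma sum_delta m (i : 'I_m) (f : 'I_m -> R) :
  \sum_p (delta_mx 0 i : 'rV[R]_m) 0 p * f p = f i.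
Proof.
rewrite (bigD1 i)//= big1 ?addr0 => [|p pi]; first by rewrite mxE !eqxx mul1r.
by rewrite mxE (negbTE pi) andbF mul0r.
Qed.

Lemma bil_raise_delta Gl x i j l : V x ->
  bil (g x) (bilc (raise_index Div Gl) x (e i) (e j)) (e l) = Gl x i j l.
Proof.
move=> Vx; rewrite bil_raise ?metric_unit//.
under eq_bigr => p _.
  under eq_bigr => q _.
    under eq_bigr => r _ do rewrite -!mulrA [(e l) _ _ * _]mulrC !mulrA mulrC.
    rewrite sum_delta -mulrA; over.
  rewrite -mulr_sumr sum_delta; over.
by rewrite sum_delta.
Qed.

(* Koszul's formula in the direction of M' reads q(lsub(bar-nabla_X Y), s) =
   d_X d_Y d_s c on the M-components, which is the defining equation of nabla. *)
Lemma nablaE x v w : V x ->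
  bilc nab x v w = lsubmx (bilc Gamma (gam x) (row_mx v 0) (row_mx w 0)).
Proof.
move=> Vx; have Ux := U_gam Vx; rewrite lsub_bilc_inL.
suff H i j k : nab x i j k = Gamma (gam x) (lshift n i) (lshift n j) (lshift n k).
  apply/rowP => k; rewrite !bilcE; apply: eq_bigr => i _.
  by apply: eq_bigr => j _; rewrite H.
rewrite -bilc_delta; transitivity
  (lsubmx (bilc Gamma (gam x) (row_mx (e i) 0) (row_mx (e j) 0)) 0 k); last first.
  by rewrite lsub_bilc_inL bilc_delta.
congr (fun_of_matrix _ 0 k); apply/eqP; rewrite -subr_eq0; apply/eqP.
(* Pairing with e_l through g is pairing with dF e_l through -q; each term in the expansion of dF
   e_l is then a case of [koszul_left]. *)
apply: (bil_unitl (metric_unit Vx)) => s.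
rewrite (row_sum_delta s) bil_sumr big1// => l _; rewrite bilZr bilDl bilNl.
rewrite bil_raise_delta// gamma_lowE// bil_metric// opprK.
rewrite [dvec _ _ _](row_sum_delta) bil_sumr.
rewrite [X in _ + X](_ : _ = \sum_m dd (e l) (fun y => F y 0 m) x *
    dd (row_mx (e i) 0) (dd (row_mx (e j) 0) (dd (row_mx 0 (e m)) C)) (gam x)).
  by rewrite addNr mulr0.
apply: eq_bigr => m _; rewrite bilZr mxE; congr (_ * _).
by rewrite (koszul_left oA oB sC compat torsion_free)// !row_mxKl.
Qed.

(** X and Y are tangent to the graph, so an ambient derivative along them is one of the restriction
    to the graph. Z is arbitrary because M-parts of Christoffel terms only see M-parts; Z = (v, 0)
    is needed later. *)
Lemma lsub_curv x X Y Z : V x -> rsubmx X = dvec (lsubmx X) F x ->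
  rsubmx Y = dvec (lsubmx Y) F x ->
  lsubmx (curv Gamma (gam x) X Y Z) =
  curv nab x (lsubmx X) (lsubmx Y) (lsubmx Z).
Proof.
move=> Vx hX hY; have Ux := U_gam Vx.
have lb y W T : V y -> lsubmx (bilc Gamma (gam y) W T) =
    bilc nab y (lsubmx W) (lsubmx T).
  move=> Vy; rewrite nablaE//.
  exact: (lsub_bilc oA oB sC compat torsion_free unitQ _ _ (U_gam Vy)).
have H W T : rsubmx W = dvec (lsubmx W) F x ->
    lsubmx (cov Gamma W (fun y => bilc Gamma y T Z) (gam x)) =
    cov nab (lsubmx W) (fun y => bilc nab y (lsubmx T) (lsubmx Z)) x.
  move=> hW; rewrite /cov linearD /= lb// lb//; congr (_ + _).
  apply/rowP => k; rewrite !mxE.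
  have hG : dfr (fun y => bilc Gamma y T Z 0 (lshift n k)) (gam x).
    by apply: dfr_bilc => i j; exact: dGamma.
  rewrite -[W]hsubmxK hW -dd_gam// row_mxKl; apply: eq_dd oV Vx _ => y Vy.
  by rewrite -lb// [RHS]mxE.
by rewrite /curv linearB /= !H.
Qed.

(** The two halves, -q(v, dF w) / 2 and -q(w, dF v) / 2, agree by symmetry of g. *)
Lemma graph_polar_metric x v w : V x ->
  h (gam x) (row_mx v (dvec v F x)) (row_mx w (dvec w F x)) = bil (g x) v w.
Proof.
move=> Vx; rewrite /h /polar_metric !row_mxKl !row_mxKr.
have := metricC v w Vx; rewrite !bil_metric// => /oppr_inj ->.
by rewrite /Q; lra.
Qed.

Lemma graph_secu x v w : V x ->
  let X := row_mx v (dvec v F x) in let Y := row_mx w (dvec w F x) in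
  h (gam x) (curv Gamma (gam x) X Y Y) X =
  1 / 2 * (bil (g x) (curv nab x v w w) v + bil (g x) (curv nab' x v w w) v).
Proof.
move=> Vx X Y; have Ux := U_gam Vx.
rewrite /h (polar_curv oA oB sC dGamma compat torsion_free unitQ)//.
rewrite !lsub_curv ?row_mxKl ?row_mxKr//.
have dn y i j k : V y -> dfr (fun t => nab t i j k) y.
  by move=> Vy; apply: dfr_raise => // *; exact: dfr_gamma_low.
have dn' y i j k : V y -> dfr (fun t => nab' t i j k) y.
  by move=> Vy; apply: dfr_raise => // *; exact: dfr_gamma_star_low.
have H1 := bil_metric (curv nab x v w w) v Vx.
(* [H2], [H3] and [H4] combine into q(R(v, w) v, dF w) = g(R'(v, w) w, v), R' being the curvature of
   [nab']. *)
have H2 := bil_metric (curv nab x v w v) w Vx.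
have H3 := dual_curv oV (fun y i j => @dfr_metric y i j) dn dn' dual_nabla v w v w Vx.
have H4 := metricC v (curv nab' x v w w) Vx.
congr (_ * _); rewrite [RHS]addrC; congr (_ + _); last exact: esym H1.
exact: oppr_inj (etrans (esym H2) (etrans H3 (congr1 -%R H4))).
Qed.

End Graph.

Lemma secuE (R : realType) (m : nat) (met : metric R m) (Gamma : christoffel R m)
    (x v w : 'rV[R]_m) :
  secu met Gamma x v w = met x (curv Gamma x v w w) v.
Proof. by rewrite /secu curvature_cst. Qed.

(** * From charts on the manifolds to the coordinate results *)

Section Charts.
Context (R : realType) (n : nat) (M M' : smoothManifold R n) (c : M -> M' -> R).
Hypothesis hc : smooth_cost c.
Hypothesis hnd : nondegenerate_cost c.
Context (phi : M -> R) (f : M -> M').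
Hypothesis hphi : smooth_fun phi.
Hypothesis hf : is_c_gradient c phi f.
Hypothesis hdiff : diffeo_onto_range f.
Context (u : chart R n M) (u' : chart R n M').
Hypothesis (hu : atlas M u) (hu' : atlas M' u').

Let A := crange u.
Let B := crange u'.
Let U := prod_range u u'.
Let C (z : 'rV[R]_(n + n)) := c (cinv u (lsubmx z)) (cinv u' (rsubmx z)).
Let F := local_expr u u' f.
Let Phi := phi \o cinv u.
Let Div := local_div c phi f u.
Let V : set 'rV[R]_n := [set a | A a /\ cdom u' (f (cinv u a))].

Let oA : open A := @crange_open _ _ _ u.
Let oB : open B := @crange_open _ _ _ u'.
Let sC : smooth_on U C := hc hu hu'.
Let oU : open U := open_product oA oB.

Lemma crange_inv (N : smoothManifold R n) (w : chart R n N) a :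
  crange w a -> cdom w (cinv w a) /\ cmap w (cinv w a) = a.
Proof. by move=> [q wq <-]; rewrite cmapK. Qed.

Lemma graph_dom_open : open V.
Proof.
rewrite openE => a [Aa Va]; rewrite /interior.
have nA : nbhs a A by exact: open_nbhs_nbhs.
have nV : nbhs a (cinv u @^-1` (f @^-1` cdom u')).
  apply: (@cinv_continuous _ _ _ u); first by rewrite inE.
  have [[fcont _] _ _] := hdiff.
  by apply: fcont; [rewrite inE|apply: open_nbhs_nbhs; split => //; exact: cdom_open].
by apply: filterS2 nA nV => y.
Qed.

Lemma graph_dom_image : V = cmap u @` (cdom u `&` setT `&` f @^-1` cdom u').
Proof.
apply/seteqP; split => a.
  move=> [/crange_inv[h1 h2] h3]; exists (cinv u a) => //.
move=> [q [[uq _] fq] <-]; split; first by exists q.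
by rewrite cmapK.
Qed.

Lemma local_expr_crange b : V b -> B (F b).
Proof. by move=> [_ h]; exists (f (cinv u b)). Qed.

Lemma local_expr_smooth : smooth_vect_on V F.
Proof. by have [[_ h] _ _] := hdiff; rewrite graph_dom_image; exact: h. Qed.

(** The gradient equation at (p, f p) has a finite right-hand side, so the transform is finite there
    and [fine] loses nothing. *)
Lemma c_transformE p :
  c_transform c phi (f p) = (c p (f p) - phi p)%:E.
Proof.
have := (hf p (f p)).2 erefl.
case: (c_transform c phi (f p)) => [r||] //=.
by rewrite -EFinD => -[<-]; rewrite addrC addKr.
Qed.

Lemma local_divE a b : A a -> V b -> Div a b =
  C (row_mx a (F b)) - Phi a + (Phi b - C (row_mx b (F b))).
Proof.
move=> Aa [Ab Vb]; rewrite /Div /local_div /c_divergence c_transformE /=.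
rewrite /C !row_mxKl !row_mxKr /F /local_expr /= cmapK// /Phi /=.
by move: (phi _) (phi _) (c _ _) (c _ _) => p q r s; ring.
Qed.

Lemma local_div_ge0 a b : A a -> V b -> 0 <= Div a b.
Proof.
move=> Aa Vb; rewrite /Div /local_div /c_divergence subr_ge0 -lee_fin.
rewrite fineK; last by rewrite c_transformE.
by apply: ereal_inf_lbound; exists (cinv u a).
Qed.

Lemma local_div_diag a : V a -> Div a a = 0.
Proof.
by move=> Va; rewrite local_divE//; [lra|case: Va].
Qed.

(** [finv] gives a left inverse of F on V, and the chain rule on the composite recovers v from dF
    v. *)
Lemma local_expr_immersion x v : V x -> dvec v F x = 0 -> v = 0.
Proof.
move=> Vx hv; have [_ _ [finv fK [_ hfinv]]] := hdiff.
pose G := local_expr u' u finv.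
have GF y : V y -> G (F y) = y.
  move=> [/crange_inv[h1 h2] h3]; rewrite /G /F /local_expr /=.
  by rewrite (cmapK h3) fK.
apply/rowP => k; rewrite mxE.
have dG : dfr (fun y => G y 0 k) (F x).
  apply: (smooth_dfr (hfinv u' u hu' hu k)).
  case: (Vx) => /crange_inv[h1 h2] h3.
  exists (f (cinv u x)) => //; split; last by rewrite /= fK.
  by split => //; exists (cinv u x).
have dF l : dfr (fun y => F y 0 l) x.
  by apply: smooth_dfr Vx; exact: local_expr_smooth.
have := dd_comp v dF dG; rewrite hv dd0v => <-.
rewrite (@eq_dd _ _ V _ (fun y => y 0 k) v x graph_dom_open Vx).
  by have /rowP/(_ k) := dvec_id v x; rewrite mxE.
by move=> y Vy; rewrite GF.
Qed.

(** [cost_mx] freezes one factor at a time; smoothness on the product turns its partials into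
    derivatives along (e_i, 0) and (0, e_j). *)
Lemma mixed_mxE z : U z ->
  mixed_mx C z = cost_mx c u u' (lsubmx z) (rsubmx z).
Proof.
move=> Uz; have [Az Bz] := Uz; apply/matrixP => i j; rewrite !mxE partialE.
have inU a : A a -> U (row_mx a (rsubmx z)).
  by move=> Aa; split; rewrite ?row_mxKl ?row_mxKr.
rewrite (@eq_dd _ _ A _ (fun a => dd (row_mx 0 (delta_mx 0 j)) C
  (row_mx a (rsubmx z))) _ _ oA Az).
  rewrite dd_row_mxl hsubmxK//.
  by apply: smooth_dfr Uz; exact: smooth_dd.
move=> a Aa; rewrite partialE -dd_row_mxr.
  by congr dd; apply/funext => b; rewrite /C row_mxKl row_mxKr.
by apply: smooth_dfr (inU a Aa).
Qed.

Lemma mixed_mx_unit z : U z -> mixed_mx C z \in unitmx.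
Proof. by move=> Uz; rewrite mixed_mxE//; case: Uz; exact: hnd. Qed.

Lemma h_metricE z X Y : U z -> h_metric c u u' z X Y = polar_metric C z X Y.
Proof.
move=> Uz; rewrite /h_metric.
have hq W : h_quad c u u' z W = - bil (mixed_mx C z) (lsubmx W) (rsubmx W).
  by rewrite mixed_mxE.
rewrite !hq /polar_metric !linearD /= !bilDl !bilDr; congr (_ / 2).
move: (bil _ _ _) (bil _ _ _) (bil _ _ _) (bil _ _ _) => p q r s; ring.
Qed.

Context (Gamma : christoffel R (n + n)).
Hypothesis hLC : is_levi_civita U (h_metric c u u') Gamma.

Lemma levi_civita_dfr z i j k : U z -> dfr (fun y => Gamma y i j k) z.
Proof. by move=> Uz; have [h _ _] := hLC; exact: smooth_dfr Uz. Qed.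

(** The defining property is tested on constant fields, for which [covd] is [bilc]. *)
Lemma levi_civita_compat z X Y Z : U z ->
  dd X (fun y => polar_metric C y Y Z) z =
  polar_metric C z (bilc Gamma z X Y) Z + polar_metric C z Y (bilc Gamma z X Z).
Proof.
move=> Uz; have [_ _ h] := hLC.
have := h (fun=> X) (fun=> Y) (fun=> Z) (smooth_vect_cst _)
  (smooth_vect_cst _) (smooth_vect_cst _) z Uz.
rewrite ddE !covd_cst2 !h_metricE// => <-.
by apply: eq_dd oU Uz _ => y Uy; rewrite h_metricE.
Qed.

Lemma levi_civita_torsion_free z X Y : U z ->
  bilc Gamma z X Y = bilc Gamma z Y X.
Proof.
move=> Uz; have [_ h _] := hLC.
have := h (fun=> X) (fun=> Y) (smooth_vect_cst _) (smooth_vect_cst _) z Uz.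
rewrite !covd_cst2 => /eqP; rewrite (_ : lie_bracket _ _ _ = 0); last first.
  by apply/rowP => k; rewrite !mxE !ddE !dd_cst subrr.
by rewrite subr_eq0 => /eqP.
Qed.

Lemma graph_sectional p X Y : cdom u p -> cdom u' (f p) ->
  graph_tangent f u u' p X -> graph_tangent f u u' p Y ->
  secu (h_metric c u u') Gamma (graph_pt f u u' p) X Y =
    1 / 2 * (sec_g c phi f u (cmap u p) (lsubmx X) (lsubmx Y) +
             sec_g_star c phi f u (cmap u p) (lsubmx X) (lsubmx Y)) /\
  h_metric c u u' (graph_pt f u u' p) X Y =
    g_metric c phi f u (cmap u p) (lsubmx X) (lsubmx Y).
Proof.
move=> up u'fp; set x := cmap u p.
have Vx : V x by split; [exists p|rewrite /x cmapK].
have Fx : F x = cmap u' (f p) by rewrite /F /local_expr /= /x cmapK.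
have tE a : \row_k 'D_a (fun y => local_expr u u' f y 0 k) x = dvec a F x.
  by apply/rowP => k; rewrite !mxE ddE.
move=> [v _ <-] [w _ <-]; rewrite !tE /graph_pt -Fx !row_mxKl.
have Ux : U (row_mx x (F x)).
  split; rewrite ?row_mxKl ?row_mxKr; first by case: Vx.
  exact: local_expr_crange.
(* Minus the c-transform along the graph, in the form given by [local_divE]. *)
have dkap b : V b -> dfr (fun y => Phi y - C (row_mx y (F y))) b.
  move=> Vb; apply: dfrB; first by apply: (smooth_dfr (hphi hu)); case: Vb.
  apply: (@dfr_comp _ _ _ (fun y => row_mx y (F y))).
    move=> l; apply: dfr_row_mx => k; first exact: dfr_coord.
    by apply: smooth_dfr Vb; exact: local_expr_smooth.
  apply: (smooth_dfr sC); split; rewrite ?row_mxKl ?row_mxKr.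
    by case: Vb.
  exact: local_expr_crange.
have VA : V `<=` A by move=> y [].
pose kap b := Phi b - C (row_mx b (F b)).
have dE : forall a b, A a -> V b -> Div a b = C (row_mx a (F b)) - Phi a + kap b.
  by move=> a b; exact: local_divE.
split; last first.
  rewrite h_metricE//.
  exact: (@graph_polar_metric R n A B C oA oB sC V F graph_dom_open VA
    local_expr_crange local_expr_smooth Phi kap Div dE (hphi hu) dkap
    local_div_ge0 local_div_diag x v w Vx).
rewrite secuE h_metricE// [sec_g _ _ _ _ _ _ _]secuE [sec_g_star _ _ _ _ _ _ _]secuE.
exact: (@graph_secu R n A B C oA oB sC V F graph_dom_open VA
  local_expr_crange local_expr_smooth Phi kap Div dE (hphi hu) dkap
  local_div_ge0 local_div_diag local_expr_immersion mixed_mx_unit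
  Gamma levi_civita_dfr levi_civita_compat levi_civita_torsion_free x v w Vx).
Qed.

End Charts.

Theorem theorem4 (R : realType) (n : nat) (hn : (2 <= n)%N)
    (M M' : smoothManifold R n) (c : M -> M' -> R)
    (hc : smooth_cost c) (hnd : nondegenerate_cost c)
    (phi : M -> R) (hphi : smooth_fun phi) (hconc : c_concave c phi)
    (f : M -> M') (hf : is_c_gradient c phi f) (hdiff : diffeo_onto_range f)
    (nabla_bar : chart R n M -> chart R n M' -> christoffel R (n + n))
    (hLC : forall u u', atlas M u -> atlas M' u' ->
       is_levi_civita (prod_range u u') (h_metric c u u') (nabla_bar u u')) :
  (forall (p : M) (u : chart R n M) (u' : chart R n M'),
     atlas M u -> atlas M' u' -> cdom u p -> cdom u' (f p) ->
     forall X Y : 'rV[R]_(n + n),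
     graph_tangent f u u' p X -> graph_tangent f u u' p Y ->
     secu (h_metric c u u') (nabla_bar u u') (graph_pt f u u' p) X Y =
       1 / 2 * (sec_g c phi f u (cmap u p) (lsubmx X) (lsubmx Y) +
                sec_g_star c phi f u (cmap u p) (lsubmx X) (lsubmx Y))) /\
  (forall lambda : R, constant_ig_curvature c phi f lambda ->
     forall (p : M) (u : chart R n M) (u' : chart R n M'),
     atlas M u -> atlas M' u' -> cdom u p -> cdom u' (f p) ->
     forall X Y : 'rV[R]_(n + n),
     graph_tangent f u u' p X -> graph_tangent f u u' p Y ->
     let h := h_metric c u u' (graph_pt f u u' p) in
     let g := fun V W : 'rV[R]_(n + n) =>
       g_metric c phi f u (cmap u p) (lsubmx V) (lsubmx W) in
     secu (h_metric c u u') (nabla_bar u u') (graph_pt f u u' p) X Y =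
       lambda * (h X X * h Y Y - h X Y ^+ 2) /\
     lambda * (h X X * h Y Y - h X Y ^+ 2) =
       lambda * (g X X * g Y Y - g X Y ^+ 2)).
Proof.
have main := graph_sectional hc hnd hphi hf hdiff.
split.
  move=> p u u' hu hu' up u'fp X Y hX hY.
  by have [] := main u u' hu hu' _ (hLC u u' hu hu') p X Y up u'fp hX hY.
move=> lambda hK p u u' hu hu' up u'fp X Y hX hY h g.
have H := main u u' hu hu' _ (hLC u u' hu hu') p _ _ up u'fp.
(* The metric identity at (X, X), (Y, Y) and (X, Y) replaces every h by g. *)
have hXX := (H X X hX hX).2; have hYY := (H Y Y hY hY).2.
have [hs hXY] := H X Y hX hY.
rewrite /h hXX hYY hXY; split=> //; rewrite hs.
have [-> ->] := hK p u hu up (lsubmx X) (lsubmx Y).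
by rewrite mulrDr -mulrDl -splitr mul1r.
Qed.
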